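(* Let $2<q<p<\infty$. If $\theta\in(0,1)$ is such that the metric space $(L_q,\|x-y\|_q^\theta)$ admits a bi-Lipschitz embedding into $L_p$, then $$\theta\le\frac{2q(p-q)+q^2(p-1)(p-2)}{2p^2(q-2)}\left(\sqrt{1+\frac{4p(p-2)(q-2)}{(pq-3q+2)^2}}-1\right)\le 1-\frac{(p-q)(q-2)}{2p^3}.$$
   Context: $L_r=L_r([0,1])$ with Lebesgue measure. A metric space $(X,d_X)$ admits a bi-Lipschitz embedding into a metric space $(Y,d_Y)$ if there are $s>0$, $D\ge1$ and $f:X\to Y$ with $s\,d_X(x,y)\le d_Y(f(x),f(y))\le Ds\,d_X(x,y)$ for all $x,y\in X$. *)

(* Defs.v *)
From Stdlib Require Import Reals ClassicalEpsilon.
Open Scope R_scope.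

(* x^p for x >= 0, with the convention 0^p = 0 (Rpower uses ln, so Rpower 0 p = 1). *)
Definition powp (x p : R) : R := if Rle_dec x 0 then 0 else Rpower x p.

(* Riemann integral over [0,1] (its value when f is Riemann integrable; arbitrary otherwise).
   RiemannInt does not depend on the integrability proof. *)
Definition Rint01 (f : R -> R) : R :=
  epsilon (inhabits 0) (fun I => exists pr : Riemann_integrable f 0 1, RiemannInt pr = I).

Definition lpd (p : R) (f g : R -> R) : R :=
  powp (Rint01 (fun x => powp (Rabs (f x - g x)) p)) (/ p).

(* L_p([0,1]) (p < oo) as the metric completion of C[0,1] under the p-norm:
   points are L_p-Cauchy sequences of continuous functions on [0,1]. *)
Record Lp (p : R) : Type := MkLp {
  lp_seq : nat -> R -> R;
  lp_cont : forall n x, 0 <= x <= 1 -> continuity_pt (lp_seq n) x;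
  lp_cauchy : forall eps, eps > 0 -> exists N : nat,
      forall m n : nat, (N <= m)%nat -> (N <= n)%nat ->
        lpd p (lp_seq m) (lp_seq n) < eps
}.
Arguments lp_seq {p} _ _ _.

(* The (pseudo)metric of L_p: the limit of the distances of the approximating sequences. *)
Definition Lp_dist (p : R) (u v : Lp p) : R :=
  epsilon (inhabits 0)
    (fun d => Un_cv (fun n => lpd p (lp_seq u n) (lp_seq v n)) d).

Definition bilip_embeds {X Y : Type} (dX : X -> X -> R) (dY : Y -> Y -> R) : Prop :=
  exists (s D : R) (f : X -> Y), s > 0 /\ D >= 1 /\
    forall x y, s * dX x y <= dY (f x) (f y) /\ dY (f x) (f y) <= D * s * dX x y.

(* Main.v *)
Require Import Defs.
From Stdlib Require Import Reals Lra Lia ZArith List.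
From Stdlib Require Import FunctionalExtensionality ClassicalEpsilon.
From Coquelicot Require Import Coquelicot.
Import List ListNotations.
Open Scope R_scope.

(** In fact [theta <= q / p], and [q / p] lies below the stated threshold. The obstruction is a
    metric X_p inequality for functions [f] on the torus [Z_M^n]: with [eta] having independent
    coordinates equal to [+1], [-1] with probability [tau / 2] each and to [0] otherwise,
    [E |f(x + 2 m eta) - f(x)|^p] is controlled by [m^p tau] times the sum of the edge energies,
    [m^p tau^(p/2)] times the diagonal energy, and a term comparing points at distance one in
    every coordinate. It is an inequality between p-th powers, so the scalar case integrates to L_p.

    On the cube, the average of [h] over the coordinates where [eta = 0] is the multi-affine
    extension of [h] evaluated at [eta]. Its martingale differences are [eta_j D_j] with [D_j]
    predictable and affine in each earlier coordinate, so a Burkholder-Rosenthal estimate for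
    [eta], convexity (to pass from [eta] back to signs) and the dyadic square function inequality
    give the cube inequality. Telescoping [m] steps along [eta] gives the torus inequality.

    For the points [sum_j tent(x_j) psi_j] of L_q with disjointly supported [psi_j], [M = 8 m] and
    [tau = m^-2], the inequality reads [m^((q-2) s) <= C (m^(p-2) n^(1-s) + 1)] with
    [s = theta p / q]; if [s > 1] this fails for [n] large after [m] large. *)

(** * Real powers *)

Lemma powp_pos (x a : R) : 0 < x -> powp x a = Rpower x a.
Proof. intros; unfold powp; destruct (Rle_dec x 0); [lra | reflexivity]. Qed.

Lemma powp_nonpos (x a : R) : x <= 0 -> powp x a = 0.
Proof. intros; unfold powp; destruct (Rle_dec x 0); [reflexivity | lra]. Qed.

Lemma powp_gt0 (x a : R) : 0 < x -> 0 < powp x a.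
Proof. intros; rewrite powp_pos by assumption; apply exp_pos. Qed.

Lemma powp_ge0 (x a : R) : 0 <= powp x a.
Proof.
  destruct (Rle_dec x 0); [rewrite powp_nonpos; lra | left; apply powp_gt0; lra].
Qed.

Lemma powp_plus (x a b : R) : powp x (a + b) = powp x a * powp x b.
Proof.
  destruct (Rle_dec x 0); [rewrite !powp_nonpos; lra |].
  rewrite !powp_pos by lra; apply Rpower_plus.
Qed.

Lemma powp_mult (x y a : R) : 0 <= x -> 0 <= y -> powp (x * y) a = powp x a * powp y a.
Proof.
  intros Hx Hy.
  destruct (Req_dec x 0) as [->|]; [rewrite Rmult_0_l, (powp_nonpos 0); lra|].
  destruct (Req_dec y 0) as [->|]; [rewrite Rmult_0_r, (powp_nonpos 0); lra|].
  assert (0 < x * y) by (apply Rmult_lt_0_compat; lra).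
  rewrite !powp_pos by lra; symmetry; apply Rpower_mult_distr; lra.
Qed.

Lemma powp_powp (x a b : R) : powp (powp x a) b = powp x (a * b).
Proof.
  destruct (Rle_dec x 0); [rewrite !powp_nonpos; try rewrite powp_nonpos; lra|].
  assert (0 < powp x a) by (apply powp_gt0; lra).
  rewrite powp_pos by assumption; rewrite !powp_pos by lra; apply Rpower_mult.
Qed.

Lemma powp_1 (x : R) : 0 <= x -> powp x 1 = x.
Proof.
  intros; destruct (Req_dec x 0) as [->|]; [apply powp_nonpos; lra|].
  rewrite powp_pos by lra; apply Rpower_1; lra.
Qed.

Lemma powp_base1 (a : R) : powp 1 a = 1.
Proof.
  rewrite powp_pos by lra; unfold Rpower; rewrite ln_1, Rmult_0_r; apply exp_0.
Qed.

Lemma powp_2 (x : R) : 0 <= x -> powp x 2 = x * x.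
Proof. intros; replace 2 with (1 + 1) by ring; rewrite powp_plus, powp_1; auto. Qed.

Lemma powp_minus1 (x a : R) : 0 <= x -> powp x a = powp x (a - 1) * x.
Proof.
  intros; rewrite <- (powp_1 x H) at 3; rewrite <- powp_plus; f_equal; ring.
Qed.

Lemma powp_le (x y a : R) : 0 <= a -> x <= y -> powp x a <= powp y a.
Proof.
  intros Ha Hxy.
  destruct (Rle_dec x 0); [rewrite (powp_nonpos x); [apply powp_ge0 | assumption]|].
  rewrite !powp_pos by lra; apply Rle_Rpower_l; lra.
Qed.

Lemma powp_inv_le (x y a : R) : 0 < a -> 0 <= y -> powp x a <= powp y a -> x <= y.
Proof.
  intros Ha Hy H.
  destruct (Rle_dec x y) as [|Hn]; [assumption | exfalso].
  destruct (Req_dec y 0) as [->|].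
  - rewrite (powp_nonpos 0) in H by lra; assert (0 < powp x a) by (apply powp_gt0; lra); lra.
  - rewrite !powp_pos in H by lra.
    assert (Rpower y a < Rpower x a) by (apply Rlt_Rpower_l; lra); lra.
Qed.

Lemma powp_Rabs_sq (x a : R) : powp (x * x) a = powp (Rabs x) (2 * a).
Proof.
  replace (x * x) with (powp (Rabs x) 2); [apply powp_powp|].
  rewrite powp_2 by apply Rabs_pos; rewrite <- Rabs_mult; apply Rabs_pos_eq; nra.
Qed.

Lemma exp_convex (l a b : R) : 0 <= l <= 1 ->
  exp (l * a + (1 - l) * b) <= l * exp a + (1 - l) * exp b.
Proof.
  intros Hl; set (c := l * a + (1 - l) * b).
  assert (tangent : forall t, exp c * (1 + (t - c)) <= exp t).
  { intros t; replace (exp t) with (exp c * exp (t - c)).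
    - apply Rmult_le_compat_l; [left; apply exp_pos | apply exp_ineq1_le].
    - rewrite <- exp_plus; f_equal; ring. }
  pose proof (tangent a) as Ta; pose proof (tangent b) as Tb.
  assert (E : exp c = l * (exp c * (1 + (a - c))) + (1 - l) * (exp c * (1 + (b - c))))
    by (unfold c; ring).
  rewrite E; apply Rplus_le_compat; apply Rmult_le_compat_l; lra.
Qed.

(** Convexity of exp between [r * ln z] and 0, evaluated at [ln z] with weight [/ r]. *)
Lemma Rpower_bernoulli (z r : R) : 0 < z -> 1 <= r -> 1 + r * (z - 1) <= Rpower z r.
Proof.
  intros Hz Hr; unfold Rpower.
  assert (Hl : 0 <= / r <= 1).
  { split; [left; apply Rinv_0_lt_compat; lra|].
    rewrite <- Rinv_1; apply Rinv_le_contravar; lra. }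
  pose proof (exp_convex (/ r) (r * ln z) 0 Hl) as H.
  replace (/ r * (r * ln z) + (1 - / r) * 0) with (ln z) in H by (field; lra).
  rewrite exp_ln, exp_0 in H by assumption.
  apply (Rmult_le_compat_l r) in H; [|lra].
  replace (r * (/ r * exp (r * ln z) + (1 - / r) * 1))
    with (exp (r * ln z) + r - 1) in H by (field; lra); lra.
Qed.

(** Bernoulli's inequality at [u / v], scaled by [v^r]. Zero arguments are treated apart because
    [powp 0] is 0 for every exponent, even exponent 0. Jensen's inequality and the drift bounds
    below rest on this tangent line. *)
Lemma powp_tangent (u v r : R) : 1 <= r -> 0 <= u -> 0 <= v ->
  powp v r + r * powp v (r - 1) * (u - v) <= powp u r.
Proof.
  intros Hr Hu Hv.
  destruct (Req_dec v 0) as [->|Hv0].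
  { rewrite !(powp_nonpos 0) by lra; pose proof (powp_ge0 u r); lra. }
  destruct (Req_dec u 0) as [->|Hu0].
  { rewrite (powp_nonpos 0) by lra; rewrite (powp_minus1 v r) by lra.
    assert (0 <= powp v (r - 1) * v) by (apply Rmult_le_pos; [apply powp_ge0 | assumption]).
    nra. }
  assert (Hz : 0 < u / v) by (apply Rdiv_lt_0_compat; lra).
  pose proof (Rpower_bernoulli _ r Hz Hr) as H.
  replace (powp u r) with (powp v r * Rpower (u / v) r).
  - apply (Rmult_le_compat_l (powp v r)) in H; [|apply powp_ge0].
    eapply Rle_trans; [|exact H].
    rewrite (powp_minus1 v r) by lra.
    right; field; lra.
  - rewrite <- powp_pos by assumption; rewrite <- powp_mult by lra; f_equal; field; lra.
Qed.

Lemma powp_diff_le (u v r : R) : 1 <= r -> 0 <= u -> 0 <= v ->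
  powp u r - powp v r <= r * powp u (r - 1) * (u - v).
Proof. intros; pose proof (powp_tangent v u r); lra. Qed.

Lemma powp_midpoint (u v r : R) : 1 <= r -> 0 <= u -> 0 <= v ->
  powp ((u + v) / 2) r <= (powp u r + powp v r) / 2.
Proof.
  intros Hr Hu Hv.
  pose proof (powp_tangent u ((u + v) / 2) r Hr Hu ltac:(lra)).
  pose proof (powp_tangent v ((u + v) / 2) r Hr Hv ltac:(lra)).
  set (k := r * powp ((u + v) / 2) (r - 1)) in *.
  replace (v - (u + v) / 2) with (- (u - (u + v) / 2)) in H0 by field; lra.
Qed.

Lemma powp_add3 (a b c r : R) : 0 <= r -> 0 <= a -> 0 <= b -> 0 <= c ->
  powp (a + b + c) r <= powp 3 r * (powp a r + powp b r + powp c r).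
Proof.
  intros Hr Ha Hb Hc.
  set (M := Rmax a (Rmax b c)).
  assert (HM : 0 <= M) by (unfold M; eapply Rle_trans; [exact Ha | apply Rmax_l]).
  apply Rle_trans with (powp (3 * M) r).
  - apply powp_le; [assumption|].
    pose proof (Rmax_l a (Rmax b c)); pose proof (Rmax_r a (Rmax b c)).
    pose proof (Rmax_l b c); pose proof (Rmax_r b c); unfold M; lra.
  - rewrite powp_mult by lra; apply Rmult_le_compat_l; [apply powp_ge0|].
    pose proof (powp_ge0 a r); pose proof (powp_ge0 b r); pose proof (powp_ge0 c r).
    unfold M, Rmax; repeat destruct (Rle_dec _ _); lra.
Qed.

Lemma powp_Rabs_sym_mean_ge (x y r : R) : 1 <= r ->
  powp (Rabs x) r <= (powp (Rabs (x + y)) r + powp (Rabs (x - y)) r) / 2.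
Proof.
  intros Hr.
  eapply Rle_trans; [|apply powp_midpoint; try apply Rabs_pos; assumption].
  apply powp_le; [lra|].
  pose proof (Rabs_triang (x + y) (x - y)) as H.
  replace (x + y + (x - y)) with (2 * x) in H by ring.
  rewrite Rabs_mult, (Rabs_pos_eq 2) in H; lra.
Qed.

(** If [x <= y], both powers are at most [(2y)^p]. Otherwise tangent lines at [x + y] and [x - y]
    bound the second difference by [p y] times the increment of [t^(p-1)] over [[x-y, x+y]]; a third
    tangent line and [x + y <= 2x] finish. *)
Lemma powp_sym_mean_le_pos (x y p : R) : 2 <= p -> 0 <= x -> 0 <= y ->
  (powp (x + y) p + powp (Rabs (x - y)) p) / 2 <=
  powp x p + p * (p - 1) * powp 2 p * (powp x (p - 2) * (y * y) + powp y p).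
Proof.
  intros Hp Hx Hy.
  assert (H2 : 1 <= powp 2 p).
  { rewrite <- (powp_base1 p) at 1; apply powp_le; lra. }
  pose proof (powp_ge0 x p) as P0; pose proof (powp_ge0 y p) as P1.
  pose proof (powp_ge0 x (p - 2)) as P2.
  assert (P3 : 0 <= powp x (p - 2) * (y * y)) by (apply Rmult_le_pos; nra).
  destruct (Rle_dec x y) as [Hxy|Hxy].
  - assert (A1 : powp (x + y) p <= powp 2 p * powp y p).
    { rewrite <- powp_mult by lra; apply powp_le; lra. }
    assert (A2 : powp (Rabs (x - y)) p <= powp 2 p * powp y p).
    { rewrite <- powp_mult by lra; apply powp_le; [lra|].
      rewrite Rabs_left1; lra. }
    assert (A3 : powp 2 p * powp y p <= p * (p - 1) * powp 2 p * powp y p).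
    { rewrite Rmult_assoc; rewrite <- (Rmult_1_l (powp 2 p * powp y p)) at 1.
      apply Rmult_le_compat_r; nra. }
    assert (0 <= p * (p - 1) * powp 2 p * (powp x (p - 2) * (y * y)))
      by (apply Rmult_le_pos; [apply Rmult_le_pos; nra | assumption]).
    nra.
  - rewrite (Rabs_pos_eq (x - y)) by lra.
    pose proof (powp_diff_le (x + y) x p ltac:(lra) ltac:(lra) Hx) as B1.
    pose proof (powp_tangent x (x - y) p ltac:(lra) Hx ltac:(lra)) as B2.
    pose proof (powp_diff_le (x + y) (x - y) (p - 1) ltac:(lra) ltac:(lra) ltac:(lra)) as B3.
    replace (p - 1 - 1) with (p - 2) in B3 by ring.
    replace (x + y - x) with y in B1 by ring.
    replace (x - (x - y)) with y in B2 by ring.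
    replace (x + y - (x - y)) with (2 * y) in B3 by ring.
    assert (B4 : powp (x + y) (p - 2) <= powp 2 p * powp x (p - 2)).
    { apply Rle_trans with (powp (2 * x) (p - 2)); [apply powp_le; lra|].
      rewrite powp_mult by lra; apply Rmult_le_compat_r; [assumption|].
      rewrite !powp_pos by lra; apply Rle_Rpower; lra. }
    assert (B5 : p * y * (powp (x + y) (p - 1) - powp (x - y) (p - 1))
                 <= p * y * ((p - 1) * powp (x + y) (p - 2) * (2 * y)))
      by (apply Rmult_le_compat_l; nra).
    assert (B6 : p * (p - 1) * (y * y) * powp (x + y) (p - 2)
                 <= p * (p - 1) * (y * y) * (powp 2 p * powp x (p - 2)))
      by (apply Rmult_le_compat_l; [apply Rmult_le_pos; nra | assumption]).
    assert (0 <= p * (p - 1) * powp 2 p * powp y p)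
      by (apply Rmult_le_pos; [apply Rmult_le_pos; nra | assumption]).
    nra.
Qed.

(** Up to order, [|x + y|] and [|x - y|] are [|x| + |y|] and [||x| - |y||], and the mean does not
    see the order. *)
Lemma powp_sym_mean_le (x y p : R) : 2 <= p ->
  (powp (Rabs (x + y)) p + powp (Rabs (x - y)) p) / 2 <=
  powp (Rabs x) p +
  p * (p - 1) * powp 2 p * (powp (Rabs x) (p - 2) * (y * y) + powp (Rabs y) p).
Proof.
  intros Hp.
  pose proof (powp_sym_mean_le_pos (Rabs x) (Rabs y) p Hp (Rabs_pos x) (Rabs_pos y)) as H.
  replace (Rabs y * Rabs y) with (y * y) in H
    by (rewrite <- Rabs_mult; symmetry; apply Rabs_pos_eq; nra).
  eapply Rle_trans; [|exact H]; right.
  assert (D : (Rabs (x + y) = Rabs x + Rabs y /\ Rabs (x - y) = Rabs (Rabs x - Rabs y)) \/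
              (Rabs (x - y) = Rabs x + Rabs y /\ Rabs (x + y) = Rabs (Rabs x - Rabs y))).
  { unfold Rabs; repeat destruct (Rcase_abs _); lra. }
  destruct D as [[-> ->]|[-> ->]]; lra.
Qed.

(** If [a <= sqrt u], then [a^(p-2) <= u^(p/2-1)] and the increment of [u^(p/2)] pays; otherwise [u
    - v = (sqrt u - sqrt v)(sqrt u + sqrt v) <= 2 a (sqrt u - sqrt v)]. It is applied with [u], [v]
    consecutive values of [tau] times the square function. *)
Lemma powp_mixed_increment (a u v p : R) : 2 <= p -> 0 <= a -> 0 <= v -> v <= u ->
  powp a (p - 2) * (u - v) <=
  2 * powp a (p - 1) * (sqrt u - sqrt v) + (powp u (p / 2) - powp v (p / 2)).
Proof.
  intros Hp Ha Hv Hvu.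
  assert (Hs : 0 <= sqrt v <= sqrt u)
    by (split; [apply sqrt_pos | apply sqrt_le_1; lra]).
  pose proof (powp_ge0 a (p - 1)) as Pa; pose proof (powp_ge0 a (p - 2)) as Pb.
  assert (Hm : powp v (p / 2) <= powp u (p / 2)) by (apply powp_le; lra).
  pose proof (sqrt_sqrt u ltac:(lra)) as Su; pose proof (sqrt_sqrt v Hv) as Sv.
  destruct (Rle_dec a (sqrt u)) as [H|H].
  - assert (E : powp a (p - 2) <= powp u (p / 2 - 1)).
    { apply Rle_trans with (powp (sqrt u) (p - 2)); [apply powp_le; lra|].
      replace (p - 2) with (2 * (p / 2 - 1)) by field.
      rewrite <- powp_powp, powp_2, Su by lra; apply Rle_refl. }
    assert (E2 : powp v (p / 2) <= powp u (p / 2 - 1) * v).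
    { rewrite (powp_minus1 v) by lra; apply Rmult_le_compat_r; [lra | apply powp_le; lra]. }
    assert (E3 : powp u (p / 2) = powp u (p / 2 - 1) * u) by (apply powp_minus1; lra).
    assert (0 <= 2 * powp a (p - 1) * (sqrt u - sqrt v)) by (apply Rmult_le_pos; lra).
    nra.
  - replace (powp a (p - 1)) with (powp a (p - 2) * a)
      by (replace (p - 2) with (p - 1 - 1) by ring; symmetry; apply powp_minus1; lra).
    assert (u - v <= 2 * a * (sqrt u - sqrt v)) by nra.
    nra.
Qed.

(** A form of Young's inequality, by splitting at [a = 2 K b]: above it half of [a^p] suffices,
    below it [a] is replaced by [2 K b]. *)
Lemma powp_absorb (K p : R) : 2 <= p -> 0 <= K -> exists C, 0 <= C /\
  forall a b, 0 <= a -> 0 <= b -> K * (powp a (p - 1) * b) <= powp a p / 2 + C * powp b p.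
Proof.
  intros Hp HK; exists (K * powp (2 * K) (p - 1)); split.
  { apply Rmult_le_pos; [assumption | apply powp_ge0]. }
  intros a b Ha Hb.
  pose proof (powp_ge0 a (p - 1)); pose proof (powp_ge0 b (p - 1)).
  destruct (Rle_dec (2 * K * b) a) as [H1|H1].
  - assert (0 <= K * powp (2 * K) (p - 1) * powp b p)
      by (repeat apply Rmult_le_pos; try apply powp_ge0; assumption).
    rewrite (powp_minus1 a p) by assumption; nra.
  - assert (powp a (p - 1) <= powp (2 * K * b) (p - 1)) by (apply powp_le; lra).
    rewrite powp_mult in H2 by lra.
    rewrite (powp_minus1 b p) by assumption.
    pose proof (powp_ge0 a p).
    assert (K * b * powp a (p - 1) <= K * b * (powp (2 * K) (p - 1) * powp b (p - 1)))
      by (apply Rmult_le_compat_l; nra).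
    nra.
Qed.

(** The same splitting, now at [w = p x^2]. *)
Lemma powp_absorb_sq (p : R) : 2 <= p -> exists C, 0 <= C /\
  forall x w, 0 <= w ->
    p / 2 * (x * x * powp w (p / 2 - 1)) <= powp w (p / 2) / 2 + C * powp (Rabs x) p.
Proof.
  intros Hp; exists (p / 2 * powp p (p / 2 - 1)); split.
  { apply Rmult_le_pos; [lra | apply powp_ge0]. }
  intros x w Hw.
  pose proof (powp_ge0 w (p / 2 - 1)).
  assert (0 <= x * x) by nra.
  replace (powp (Rabs x) p) with (powp (x * x) (p / 2))
    by (rewrite powp_Rabs_sq; f_equal; field).
  destruct (Rle_dec (p * (x * x)) w) as [H1|H1].
  - assert (0 <= p / 2 * powp p (p / 2 - 1) * powp (x * x) (p / 2))
      by (repeat apply Rmult_le_pos; try apply powp_ge0; lra).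
    rewrite (powp_minus1 w (p / 2)) by assumption; nra.
  - assert (H2 : powp w (p / 2 - 1) <= powp (p * (x * x)) (p / 2 - 1)) by (apply powp_le; lra).
    rewrite powp_mult in H2 by lra.
    rewrite (powp_minus1 (x * x) (p / 2)) by assumption.
    pose proof (powp_ge0 w (p / 2)).
    assert (p / 2 * (x * x) * powp w (p / 2 - 1) <=
            p / 2 * (x * x) * (powp p (p / 2 - 1) * powp (x * x) (p / 2 - 1)))
      by (apply Rmult_le_compat_l; nra).
    nra.
Qed.

(** * Finitely supported measures *)

Fixpoint bsum (n : nat) (g : nat -> R) : R :=
  match n with O => 0 | S k => bsum k g + g k end.

Lemma bsum_S (n : nat) (g : nat -> R) : bsum (S n) g = bsum n g + g n.
Proof. reflexivity. Qed.

Lemma bsum_le (n : nat) (f g : nat -> R) :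
  (forall i, (i < n)%nat -> f i <= g i) -> bsum n f <= bsum n g.
Proof.
  induction n as [|n IH]; simpl; intros H; [lra|].
  apply Rplus_le_compat; [apply IH; intros; apply H; lia | apply H; lia].
Qed.

Lemma bsum_ext (n : nat) (f g : nat -> R) :
  (forall i, (i < n)%nat -> f i = g i) -> bsum n f = bsum n g.
Proof. intros H; apply Rle_antisym; apply bsum_le; intros i Hi; rewrite H; auto; lra. Qed.

Lemma bsum_const (n : nat) (c : R) : bsum n (fun _ => c) = INR n * c.
Proof. induction n as [|n IH]; [simpl; ring | rewrite S_INR; simpl; rewrite IH; ring]. Qed.

Lemma bsum_plus (n : nat) (f g : nat -> R) :
  bsum n (fun i => f i + g i) = bsum n f + bsum n g.
Proof. induction n as [|n IH]; simpl; [ring | rewrite IH; ring]. Qed.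

Lemma bsum_scal (n : nat) (c : R) (f : nat -> R) : bsum n (fun i => c * f i) = c * bsum n f.
Proof. induction n as [|n IH]; simpl; [ring | rewrite IH; ring]. Qed.

Lemma bsum_ge0 (n : nat) (f : nat -> R) : (forall i, 0 <= f i) -> 0 <= bsum n f.
Proof.
  intros H; induction n as [|n IH]; simpl; [lra | specialize (H n); lra].
Qed.

Definition wsum {A : Type} (mu : list (R * A)) (G : A -> R) : R :=
  fold_right (fun a s => fst a * G (snd a) + s) 0 mu.

Lemma wsum_ext {A : Type} (mu : list (R * A)) (F G : A -> R) :
  (forall a, F a = G a) -> wsum mu F = wsum mu G.
Proof. intros H; f_equal; extensionality a; apply H. Qed.

Lemma wsum_plus {A : Type} (mu : list (R * A)) (F G : A -> R) :
  wsum mu (fun a => F a + G a) = wsum mu F + wsum mu G.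
Proof. induction mu as [|a mu IH]; simpl; [ring | rewrite IH; ring]. Qed.

Lemma wsum_scal {A : Type} (mu : list (R * A)) (c : R) (F : A -> R) :
  wsum mu (fun a => c * F a) = c * wsum mu F.
Proof. induction mu as [|a mu IH]; simpl; [ring | rewrite IH; ring]. Qed.

Lemma wsum_minus {A : Type} (mu : list (R * A)) (F G : A -> R) :
  wsum mu (fun a => F a - G a) = wsum mu F - wsum mu G.
Proof. induction mu as [|a mu IH]; simpl; [ring | rewrite IH; ring]. Qed.

Lemma wsum_const {A : Type} (mu : list (R * A)) (c : R) :
  wsum mu (fun _ => c) = c * wsum mu (fun _ => 1).
Proof. rewrite <- wsum_scal; apply wsum_ext; intros; ring. Qed.

Lemma wsum_swap {A B : Type} (mu : list (R * A)) (nu : list (R * B)) (G : A -> B -> R) :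
  wsum mu (fun a => wsum nu (G a)) = wsum nu (fun b => wsum mu (fun a => G a b)).
Proof.
  induction mu as [|a mu IH]; simpl.
  - rewrite wsum_const; ring.
  - rewrite wsum_plus, wsum_scal, IH; reflexivity.
Qed.

Lemma wsum_bsum {A : Type} (mu : list (R * A)) (n : nat) (G : nat -> A -> R) :
  wsum mu (fun a => bsum n (fun i => G i a)) = bsum n (fun i => wsum mu (G i)).
Proof.
  induction n as [|n IH]; simpl; [rewrite wsum_const; ring | rewrite wsum_plus, IH; reflexivity].
Qed.

Lemma wsum_app {A : Type} (mu nu : list (R * A)) (G : A -> R) :
  wsum (mu ++ nu) G = wsum mu G + wsum nu G.
Proof. induction mu as [|a mu IH]; simpl; [ring | rewrite IH; ring]. Qed.

Lemma wsum_map {A B : Type} (c : R) (g : B -> A) (mu : list (R * B)) (G : A -> R) :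
  wsum (map (fun b => (c * fst b, g (snd b))) mu) G = c * wsum mu (fun b => G (g b)).
Proof. induction mu as [|a mu IH]; simpl; [ring | rewrite IH; ring]. Qed.

(** The predicate [P] holds at every atom, so that integrands need to be compared only where [P]
    holds. *)
Definition prob {A : Type} (mu : list (R * A)) (P : A -> Prop) : Prop :=
  Forall (fun a => 0 <= fst a /\ P (snd a)) mu /\ wsum mu (fun _ => 1) = 1.

Lemma prob_const {A : Type} (mu : list (R * A)) (P : A -> Prop) (c : R) :
  prob mu P -> wsum mu (fun _ => c) = c.
Proof. intros [_ H]; rewrite wsum_const, H; ring. Qed.

Lemma prob_le {A : Type} (mu : list (R * A)) (P : A -> Prop) (F G : A -> R) :
  prob mu P -> (forall a, P a -> F a <= G a) -> wsum mu F <= wsum mu G.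
Proof.
  intros [H _] HFG; induction H as [|a mu [Ha Pa] _ IH]; simpl; [lra|].
  apply Rplus_le_compat; [apply Rmult_le_compat_l; auto | exact IH].
Qed.

Lemma prob_le_const {A : Type} (mu : list (R * A)) (P : A -> Prop) (F : A -> R) (c : R) :
  prob mu P -> (forall a, P a -> F a <= c) -> wsum mu F <= c.
Proof. intros H E; rewrite <- (prob_const mu P c H); apply (prob_le _ P); auto. Qed.

Lemma prob_ge_const {A : Type} (mu : list (R * A)) (P : A -> Prop) (F : A -> R) (c : R) :
  prob mu P -> (forall a, P a -> c <= F a) -> c <= wsum mu F.
Proof. intros H E; rewrite <- (prob_const mu P c H); apply (prob_le _ P); auto. Qed.

(** Average the tangent inequality at the mean: its linear term integrates to 0. *)
Lemma prob_jensen {A : Type} (mu : list (R * A)) (P : A -> Prop) (F : A -> R) (r : R) :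
  1 <= r -> prob mu P -> (forall a, 0 <= F a) ->
  powp (wsum mu F) r <= wsum mu (fun a => powp (F a) r).
Proof.
  intros Hr H HF.
  set (m := wsum mu F).
  assert (Hm : 0 <= m) by (apply (prob_ge_const mu P); auto).
  apply Rle_trans with (wsum mu (fun a => powp m r + r * powp m (r - 1) * (F a - m))).
  - rewrite wsum_plus, wsum_scal, wsum_minus, !(prob_const _ P) by assumption.
    fold m; lra.
  - apply (prob_le _ P); auto; intros; apply powp_tangent; auto.
Qed.

Lemma prob_Rabs {A : Type} (mu : list (R * A)) (P : A -> Prop) (F : A -> R) :
  prob mu P -> Rabs (wsum mu F) <= wsum mu (fun a => Rabs (F a)).
Proof.
  intros H; apply Rabs_le; split.
  - replace (- wsum mu (fun a => Rabs (F a))) with (wsum mu (fun a => -1 * Rabs (F a)))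
      by (rewrite wsum_scal; ring).
    apply (prob_le _ P); auto; intros a _; pose proof (Rle_abs (- F a)).
    rewrite Rabs_Ropp in H0; lra.
  - apply (prob_le _ P); auto; intros a _; apply Rle_abs.
Qed.

Lemma prob_jensen_Rabs {A : Type} (mu : list (R * A)) (P : A -> Prop) (F : A -> R) (r : R) :
  1 <= r -> prob mu P ->
  powp (Rabs (wsum mu F)) r <= wsum mu (fun a => powp (Rabs (F a)) r).
Proof.
  intros Hr H.
  eapply Rle_trans; [apply powp_le; [lra | apply (prob_Rabs _ P); assumption]|].
  apply (prob_jensen _ P); auto; intros; apply Rabs_pos.
Qed.

(** * Product measures on integer configurations *)

(** Points of Z^n for all [n] share one type: [pm] makes the coordinates from [n] on equal to 0, so
    that passing from [n] to [n + 1] is a single [upd]. *)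
Definition cfg : Type := nat -> Z.

Definition zeroc : cfg := fun _ => 0%Z.

Definition upd (x : cfg) (j : nat) (v : Z) : cfg := fun i => if Nat.eq_dec i j then v else x i.

(** For a multi-affine [h], zeroing a coordinate averages over its sign, so [h (trunc j x)] is the
    conditional expectation of [h] given the first [j] signs. *)
Definition trunc (j : nat) (x : cfg) : cfg := fun i => if lt_dec i j then x i else 0%Z.

Ltac cfg_ext :=
  let i := fresh "i" in
  extensionality i; unfold upd, trunc, zeroc;
  repeat (destruct (Nat.eq_dec _ _) || destruct (lt_dec _ _)); subst; try reflexivity;
  try lia; try congruence.

Lemma upd_upd_same (x : cfg) (j : nat) (v w : Z) : upd (upd x j v) j w = upd x j w.
Proof. cfg_ext. Qed.

Lemma upd_comm (x : cfg) (i j : nat) (v w : Z) :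
  i <> j -> upd (upd x i v) j w = upd (upd x j w) i v.
Proof. intros; cfg_ext. Qed.

Lemma upd_self (x : cfg) (j : nat) (v : Z) : x j = v -> upd x j v = x.
Proof. intros; cfg_ext. Qed.

Lemma trunc_upd_ge (x : cfg) (i j : nat) (v : Z) :
  (i <= j)%nat -> trunc i (upd x j v) = trunc i x.
Proof. intros; cfg_ext. Qed.

Lemma trunc_upd_lt (x : cfg) (i j : nat) (v : Z) :
  (j < i)%nat -> trunc i (upd x j v) = upd (trunc i x) j v.
Proof. intros; cfg_ext. Qed.

Lemma trunc_id (x : cfg) (j : nat) :
  (forall i, (j <= i)%nat -> x i = 0%Z) -> trunc j x = x.
Proof. intros H; cfg_ext; symmetry; apply H; lia. Qed.

(** The law of [n] independent coordinates distributed as [mu]. *)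
Fixpoint pm (mu : list (R * Z)) (n : nat) : list (R * cfg) :=
  match n with
  | O => [(1, zeroc)]
  | S k => flat_map (fun a => map (fun b => (fst a * fst b, upd (snd a) k (snd b))) mu) (pm mu k)
  end.

Lemma wsum_pm_0 (mu : list (R * Z)) (G : cfg -> R) : wsum (pm mu 0) G = G zeroc.
Proof. simpl; ring. Qed.

Lemma wsum_pm_S (mu : list (R * Z)) (n : nat) (G : cfg -> R) :
  wsum (pm mu (S n)) G = wsum (pm mu n) (fun x => wsum mu (fun v => G (upd x n v))).
Proof.
  simpl; induction (pm mu n) as [|a l IH]; simpl; [reflexivity|].
  rewrite wsum_app, IH; f_equal.
  apply (wsum_map (fst a) (fun v => upd (snd a) n v)).
Qed.

Lemma pm_prob (mu : list (R * Z)) (P : Z -> Prop) (n : nat) : prob mu P ->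
  prob (pm mu n) (fun x => (forall i, (i < n)%nat -> P (x i)) /\
                           (forall i, (n <= i)%nat -> x i = 0%Z)).
Proof.
  intros [H1 H2]; induction n as [|n [IH1 IH2]].
  - split; [|simpl; ring].
    repeat constructor; simpl; [lra | intros; lia].
  - split.
    + simpl; rewrite Forall_forall in *; intros c Hc.
      apply in_flat_map in Hc; destruct Hc as [a [Ha Hc]].
      apply in_map_iff in Hc; destruct Hc as [b [<- Hb]]; simpl.
      destruct (IH1 a Ha) as [A1 [A2 A3]]; destruct (H1 b Hb) as [B1 B2].
      repeat split; [apply Rmult_le_pos; assumption | |]; intros i Hi; unfold upd;
        destruct (Nat.eq_dec i n); subst; auto; try lia; [apply A2 | apply A3]; lia.
    + rewrite wsum_pm_S; etransitivity; [|exact IH2]; apply wsum_ext; intros; exact H2.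
Qed.

(** Redrawing one coordinate independently does not change the law. This yields the marginals and
    lets a coordinate other than the last be averaged first. *)
Lemma pm_resample (mu : list (R * Z)) (P : Z -> Prop) (n j : nat) (G : cfg -> R) :
  prob mu P -> (j < n)%nat ->
  wsum (pm mu n) G = wsum (pm mu n) (fun x => wsum mu (fun v => G (upd x j v))).
Proof.
  intros H; revert G; induction n as [|n IH]; intros G Hj; [lia|].
  rewrite !wsum_pm_S.
  destruct (Nat.eq_dec j n) as [->|Hn].
  - apply wsum_ext; intros x.
    rewrite <- (prob_const mu P (wsum mu (fun v => G (upd x n v))) H) at 1.
    apply wsum_ext; intros w; apply wsum_ext; intros v; rewrite upd_upd_same; reflexivity.
  - rewrite IH by lia; apply wsum_ext; intros x; rewrite wsum_swap.
    apply wsum_ext; intros w; apply wsum_ext; intros v; rewrite upd_comm by lia; reflexivity.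
Qed.

Lemma pm_marginal (mu : list (R * Z)) (P : Z -> Prop) (n j : nat) (g : Z -> R) :
  prob mu P -> (j < n)%nat -> wsum (pm mu n) (fun x => g (x j)) = wsum mu g.
Proof.
  intros H Hj; rewrite (pm_resample mu P n j) by assumption.
  rewrite <- (prob_const (pm mu n) _ (wsum mu g) (pm_prob mu P n H)).
  apply wsum_ext; intros x; apply wsum_ext; intros v.
  unfold upd; destruct (Nat.eq_dec j j); congruence.
Qed.

Definition tern (v : Z) : Prop := (-1 <= v <= 1)%Z.

Definition sgn : list (R * Z) := [(/ 2, 1%Z); (/ 2, (-1)%Z)].

Definition tri (tau : R) : list (R * Z) := [(tau / 2, 1%Z); (tau / 2, (-1)%Z); (1 - tau, 0%Z)].

Lemma sgn_prob : prob sgn tern.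
Proof.
  split; [|simpl; field].
  repeat apply Forall_cons; try apply Forall_nil; unfold tern; simpl; split; lra || lia.
Qed.

Lemma tri_prob (tau : R) : 0 <= tau <= 1 -> prob (tri tau) tern.
Proof.
  intros; split; [|simpl; field].
  repeat apply Forall_cons; try apply Forall_nil; unfold tern; simpl; split; lra || lia.
Qed.

Lemma wsum_sgn (G : Z -> R) : wsum sgn G = (G 1%Z + G (-1)%Z) / 2.
Proof. simpl; field. Qed.

Lemma wsum_tri (tau : R) (G : Z -> R) :
  wsum (tri tau) G = tau * ((G 1%Z + G (-1)%Z) / 2) + (1 - tau) * G 0%Z.
Proof. simpl; field. Qed.

Definition cfg_opp (x : cfg) : cfg := fun i => (- x i)%Z.

Lemma pm_sgn_opp (n : nat) (G : cfg -> R) :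
  wsum (pm sgn n) (fun x => G (cfg_opp x)) = wsum (pm sgn n) G.
Proof.
  revert G; induction n as [|n IH]; intros G.
  - rewrite !wsum_pm_0; f_equal.
  - rewrite !wsum_pm_S, <- (IH (fun x => wsum sgn (fun v => G (upd x n v)))).
    apply wsum_ext; intros x; rewrite !wsum_sgn.
    replace (cfg_opp (upd x n 1)) with (upd (cfg_opp x) n (-1))
      by (unfold cfg_opp; cfg_ext).
    replace (cfg_opp (upd x n (-1))) with (upd (cfg_opp x) n 1)
      by (unfold cfg_opp; cfg_ext).
    lra.
Qed.

(** * The hypercube inequality *)

Definition midconvex (n : nat) (G : cfg -> R) : Prop :=
  forall x j, (j < n)%nat -> G (upd x j 0) <= (G (upd x j 1) + G (upd x j (-1))) / 2.

(** Splitting the mass at 0 evenly between 1 and -1 can only raise the mean. The coordinates are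
    exchanged one at a time: averaging the last one over signs keeps midpoint convexity in the
    others. *)
Lemma midconvex_mono (tau : R) (n : nat) (G : cfg -> R) : 0 <= tau <= 1 ->
  midconvex n G -> wsum (pm (tri tau) n) G <= wsum (pm sgn n) G.
Proof.
  intros Ht; revert G; induction n as [|n IH]; intros G HG.
  - rewrite !wsum_pm_0; lra.
  - rewrite !wsum_pm_S.
    eapply Rle_trans; [|apply IH].
    + apply (prob_le _ _ _ _ (pm_prob _ _ n (tri_prob tau Ht))); intros x _.
      rewrite wsum_tri, wsum_sgn; specialize (HG x n ltac:(lia)); nra.
    + intros x j Hj; rewrite !wsum_sgn.
      rewrite !(upd_comm x j n) by lia.
      pose proof (HG (upd x n 1) j ltac:(lia)); pose proof (HG (upd x n (-1)) j ltac:(lia)).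
      lra.
Qed.

(** Under [pm sgn n] the later coordinates are 0; turning them into random signs raises the mean by
    midpoint convexity. *)
Lemma midconvex_dim_mono (n d : nat) (G : cfg -> R) :
  midconvex (n + d) G -> wsum (pm sgn n) G <= wsum (pm sgn (n + d)) G.
Proof.
  induction d as [|d IH]; intros HG; [rewrite Nat.add_0_r; lra|].
  eapply Rle_trans; [apply IH; intros x j Hj; apply HG; lia|].
  rewrite Nat.add_succ_r, wsum_pm_S.
  apply (prob_le _ _ _ _ (pm_prob _ _ (n + d) sgn_prob)); intros x [_ Hx].
  rewrite wsum_sgn.
  rewrite <- (upd_self x (n + d) 0) at 1 by (apply Hx; lia).
  apply HG; lia.
Qed.

(** Only the values -1, 0, 1 occur: on these, [h] is the multi-affine extension of its restriction
    to the sign cube. *)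
Definition multi_affine (n : nat) (h : cfg -> R) : Prop :=
  forall x j, (j < n)%nat -> h (upd x j 0) = (h (upd x j 1) + h (upd x j (-1))) / 2.

Definition hdiff (h : cfg -> R) (j : nat) (x : cfg) : R := (h (upd x j 1) - h (upd x j (-1))) / 2.

(* [hdiff h i (trunc i x)] is the [i]-th martingale difference of [h], up to the sign [x i]. *)
Definition sqfun (h : cfg -> R) (n : nat) (x : cfg) : R :=
  bsum n (fun i => hdiff h i (trunc i x) * hdiff h i (trunc i x)).

Lemma sqfun_ge0 (h : cfg -> R) (n : nat) (x : cfg) : 0 <= sqfun h n x.
Proof. apply bsum_ge0; intros; nra. Qed.

Lemma sqfun_upd (h : cfg -> R) (j : nat) (x : cfg) (v : Z) :
  (forall i, (j <= i)%nat -> x i = 0%Z) ->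
  sqfun h (S j) (upd x j v) = sqfun h j x + hdiff h j x * hdiff h j x.
Proof.
  intros Hx; unfold sqfun; simpl; rewrite trunc_upd_ge, trunc_id by auto; f_equal.
  apply bsum_ext; intros i Hi; rewrite trunc_upd_ge by lia; reflexivity.
Qed.

Lemma multi_affine_upd (n : nat) (h : cfg -> R) (j : nat) (x : cfg) :
  multi_affine n h -> (j < n)%nat -> (forall i, (j <= i)%nat -> x i = 0%Z) ->
  h (upd x j 0) = h x /\ h (upd x j 1) = h x + hdiff h j x /\
  h (upd x j (-1)) = h x - hdiff h j x.
Proof.
  intros Hh Hj Hx.
  assert (E : upd x j 0 = x) by (apply upd_self; auto).
  pose proof (Hh x j Hj) as H; rewrite E in *; unfold hdiff; lra.
Qed.

Lemma hdiff_affine (n : nat) (h : cfg -> R) (i j : nat) (x : cfg) :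
  multi_affine n h -> (j < n)%nat -> i <> j ->
  hdiff h i (upd x j 0) = (hdiff h i (upd x j 1) + hdiff h i (upd x j (-1))) / 2.
Proof.
  intros Hh Hj Hij; unfold hdiff; rewrite !(upd_comm x j i) by auto.
  rewrite !(Hh _ j Hj); field.
Qed.

(** [hdiff h i] does not depend on coordinate [i] and is affine in every other one; a convex
    function of it is then convex in each coordinate. *)
Lemma hdiff_pow_midconvex (n : nat) (h : cfg -> R) (i : nat) (p : R) :
  1 <= p -> multi_affine n h -> midconvex n (fun x => powp (Rabs (hdiff h i x)) p).
Proof.
  intros Hp Hh x j Hj.
  destruct (Nat.eq_dec i j) as [->|Hij].
  - unfold hdiff; rewrite !upd_upd_same; lra.
  - rewrite (hdiff_affine n h i j x Hh Hj Hij).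
    eapply Rle_trans; [|apply powp_midpoint; try apply Rabs_pos; assumption].
    apply powp_le; [lra|].
    unfold Rdiv; rewrite Rabs_mult, (Rabs_pos_eq (/ 2)) by lra.
    apply Rmult_le_compat_r; [lra | apply Rabs_triang].
Qed.

(** Term [i] of the square function ignores coordinate [j] when [i <= j], and is the square of an
    affine function of it when [i > j]. The convex increasing power [r] preserves the convexity. *)
Lemma sqfun_pow_midconvex (n : nat) (h : cfg -> R) (r : R) :
  1 <= r -> multi_affine n h -> midconvex n (fun x => powp (sqfun h n x) r).
Proof.
  intros Hr Hh x j Hj.
  eapply Rle_trans; [|apply powp_midpoint; try apply sqfun_ge0; assumption].
  apply powp_le; [lra|].
  apply Rle_trans with (/ 2 * (sqfun h n (upd x j 1) + sqfun h n (upd x j (-1)))); [|lra].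
  unfold sqfun; rewrite <- bsum_plus, <- bsum_scal; apply bsum_le; intros i Hi.
  destruct (le_lt_dec i j) as [Hij|Hij].
  - rewrite !trunc_upd_ge by assumption; lra.
  - rewrite !trunc_upd_lt by assumption.
    rewrite (hdiff_affine n h i j) by (assumption || lia).
    set (a := hdiff h i (upd (trunc i x) j 1)).
    set (b := hdiff h i (upd (trunc i x) j (-1))).
    pose proof (Rle_0_sqr (a - b)); unfold Rsqr in *; lra.
Qed.

(* Dyadic Burkholder inequality: since [h_j^2 - sum of squares] is a martingale and the square
   function is predictable, [W^(p/2) - (p/2) h^2 W^(p/2-1)] is a supermartingale. *)
Lemma square_function_le (p : R) : 2 <= p -> exists C, 0 <= C /\
  forall n h, multi_affine n h -> h zeroc = 0 ->
    wsum (pm sgn n) (fun x => powp (sqfun h n x) (p / 2)) <=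
    C * wsum (pm sgn n) (fun x => powp (Rabs (h x)) p).
Proof.
  intros Hp; destruct (powp_absorb_sq p Hp) as [C [HC HY]].
  exists (2 * C); split; [lra|]; intros n h Hh H0.
  set (G := fun j x => powp (sqfun h j x) (p / 2)
                       - p / 2 * (h x * h x * powp (sqfun h j x) (p / 2 - 1))).
  assert (HG : forall j, (j <= n)%nat -> wsum (pm sgn j) (G j) <= 0).
  { induction j as [|j IH]; intros Hj.
    - rewrite wsum_pm_0; unfold G, sqfun; simpl.
      rewrite H0, !(powp_nonpos 0); lra.
    - eapply Rle_trans; [|apply IH; lia].
      rewrite wsum_pm_S.
      apply (prob_le _ _ _ _ (pm_prob _ _ j sgn_prob)); intros x [_ Hx].
      rewrite wsum_sgn; unfold G; rewrite !sqfun_upd by assumption.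
      destruct (multi_affine_upd n h j x Hh ltac:(lia) Hx) as [_ [-> ->]].
      set (D := hdiff h j x); set (W := sqfun h j x); set (H := h x).
      assert (HW : 0 <= W) by apply sqfun_ge0.
      assert (HD : 0 <= D * D) by nra.
      (* The increment of [W^(p/2)] is at most [(p/2) D^2 (W + D^2)^(p/2-1)]. This is cancelled
         because the conditional mean of [h^2] grows from [H^2] to [H^2 + D^2]. *)
      pose proof (powp_diff_le (W + D * D) W (p / 2) ltac:(lra) ltac:(lra) HW) as T.
      replace (W + D * D - W) with (D * D) in T by ring.
      assert (M : H * H * powp W (p / 2 - 1) <= H * H * powp (W + D * D) (p / 2 - 1))
        by (apply Rmult_le_compat_l; [nra | apply powp_le; lra]).
      nra. }
  specialize (HG n (le_n n)); unfold G in HG.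
  rewrite wsum_minus, wsum_scal in HG.
  assert (HY' : p / 2 * wsum (pm sgn n) (fun x => h x * h x * powp (sqfun h n x) (p / 2 - 1))
    <= / 2 * wsum (pm sgn n) (fun x => powp (sqfun h n x) (p / 2))
       + C * wsum (pm sgn n) (fun x => powp (Rabs (h x)) p)).
  { rewrite <- !wsum_scal, <- wsum_plus.
    apply (prob_le _ _ _ _ (pm_prob _ _ n sgn_prob)); intros x _.
    specialize (HY (h x) (sqfun h n x) (sqfun_ge0 _ _ _)); lra. }
  lra.
Qed.

(* Conditional Rosenthal inequality. That [|h|^(p-1)] is a submartingale makes the correction term
   [2 |h|^(p-1) (tau W)^(1/2)] absorb the drift of [|h|^p], with no maximal inequality. *)
Lemma sparse_rosenthal (p : R) : 2 <= p -> exists C, 0 <= C /\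
  forall n tau h, 0 <= tau <= 1 -> multi_affine n h -> h zeroc = 0 ->
    wsum (pm (tri tau) n) (fun x => powp (Rabs (h x)) p) <=
    C * (wsum (pm (tri tau) n) (fun x => powp (tau * sqfun h n x) (p / 2)) +
         tau * bsum n (fun j => wsum (pm (tri tau) j) (fun x => powp (Rabs (hdiff h j x)) p))).
Proof.
  intros Hp; set (K := p * (p - 1) * powp 2 p).
  assert (HK : 0 <= K) by (apply Rmult_le_pos; [nra | apply powp_ge0]).
  destruct (powp_absorb (2 * K) p Hp ltac:(lra)) as [C [HC HY]].
  (* Absorption will leave [E / 2 <= (C + K) V + K tau B], hence the factor 2. *)
  exists (2 * (C + K)); split; [lra|]; intros n tau h Ht Hh H0.
  set (G := fun j x => powp (Rabs (h x)) p
    - K * (2 * powp (Rabs (h x)) (p - 1) * sqrt (tau * sqfun h j x)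
           + powp (tau * sqfun h j x) (p / 2))).
  set (B := fun j => bsum j (fun j => wsum (pm (tri tau) j) (fun x => powp (Rabs (hdiff h j x)) p))).
  assert (HG : forall j, (j <= n)%nat -> wsum (pm (tri tau) j) (G j) <= K * tau * B j).
  { induction j as [|j IH]; intros Hj.
    - rewrite wsum_pm_0; unfold G, B, sqfun; simpl.
      rewrite H0, Rabs_R0, !Rmult_0_r, sqrt_0, !(powp_nonpos 0); lra.
    - unfold B; simpl bsum; fold (B j).
      specialize (IH ltac:(lia)).
      rewrite Rmult_plus_distr_l, <- wsum_scal.
      eapply Rle_trans; [|apply Rplus_le_compat_r; exact IH].
      rewrite <- wsum_plus, wsum_pm_S.
      apply (prob_le _ _ _ _ (pm_prob _ _ j (tri_prob tau Ht))); intros x [_ Hx].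
      rewrite wsum_tri; unfold G; rewrite !sqfun_upd by assumption.
      destruct (multi_affine_upd n h j x Hh ltac:(lia) Hx) as [-> [-> ->]].
      set (D := hdiff h j x); set (W := sqfun h j x); set (H := h x).
      assert (HW : 0 <= W) by apply sqfun_ge0.
      pose proof (powp_sym_mean_le H D p Hp) as T1; fold K in T1.
      pose proof (powp_Rabs_sym_mean_ge H D (p - 1) ltac:(lra)) as T2.
      pose proof (powp_mixed_increment (Rabs H) (tau * (W + D * D)) (tau * W) p Hp
        (Rabs_pos H) ltac:(apply Rmult_le_pos; lra) ltac:(apply Rmult_le_compat_l; nra)) as T3.
      replace (tau * (W + D * D) - tau * W) with (tau * (D * D)) in T3 by ring.
      pose proof (sqrt_pos (tau * (W + D * D))) as Q.
      set (s1 := sqrt (tau * (W + D * D))) in *; set (s0 := sqrt (tau * W)) in *.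
      set (u1 := powp (tau * (W + D * D)) (p / 2)) in *; set (u0 := powp (tau * W) (p / 2)) in *.
      set (a1 := powp (Rabs (H + D)) p) in *; set (a2 := powp (Rabs (H - D)) p) in *.
      set (b1 := powp (Rabs (H + D)) (p - 1)) in *; set (b2 := powp (Rabs (H - D)) (p - 1)) in *.
      set (a0 := powp (Rabs H) p) in *; set (b0 := powp (Rabs H) (p - 1)) in *.
      set (c0 := powp (Rabs H) (p - 2)) in *; set (d := powp (Rabs D) p) in *.
      (* [S1] is the second-order drift of [|h|^p], weighted by the probability [tau] of a nonzero
         coordinate. [S2] is the submartingale property of [|h|^(p-1)], which keeps the correction
         at least at its old value of [|h|^(p-1)]. [S3] pays for the mixed term of [S1] with the
         increments of [sqrt (tau W)] and [(tau W)^(p/2)]. *)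
      assert (S1 : tau * ((a1 + a2) / 2) <= tau * (a0 + K * (c0 * (D * D) + d)))
        by (apply Rmult_le_compat_l; lra).
      assert (S2 : K * (2 * s1 * (tau * b0)) <= K * (2 * s1 * (tau * ((b1 + b2) / 2))))
        by (apply Rmult_le_compat_l; [lra|]; apply Rmult_le_compat_l; [lra|];
            apply Rmult_le_compat_l; lra).
      assert (S3 : K * (c0 * (tau * (D * D))) <= K * (2 * b0 * (s1 - s0) + (u1 - u0)))
        by (apply Rmult_le_compat_l; lra).
      lra. }
  specialize (HG n (le_n n)); unfold G in HG; fold (B n).
  rewrite wsum_minus, wsum_scal, wsum_plus in HG.
  set (V := wsum (pm (tri tau) n) (fun x => powp (tau * sqfun h n x) (p / 2))) in *.
  set (E := wsum (pm (tri tau) n) (fun x => powp (Rabs (h x)) p)) in *.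
  assert (HY' : K * wsum (pm (tri tau) n)
     (fun x => 2 * powp (Rabs (h x)) (p - 1) * sqrt (tau * sqfun h n x)) <= / 2 * E + C * V).
  { unfold E, V; rewrite <- !wsum_scal, <- wsum_plus.
    apply (prob_le _ _ _ _ (pm_prob _ _ n (tri_prob tau Ht))); intros x _.
    assert (HW : 0 <= tau * sqfun h n x) by (apply Rmult_le_pos; [lra | apply sqfun_ge0]).
    specialize (HY (Rabs (h x)) (sqrt (tau * sqfun h n x)) (Rabs_pos _) (sqrt_pos _)).
    replace (powp (sqrt (tau * sqfun h n x)) p) with (powp (tau * sqfun h n x) (p / 2)) in HY.
    - lra.
    - rewrite <- (sqrt_sqrt _ HW) at 1; rewrite powp_Rabs_sq, Rabs_pos_eq by apply sqrt_pos.
      f_equal; field. }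
  assert (HB : 0 <= tau * B n).
  { apply Rmult_le_pos; [lra|]; apply bsum_ge0; intros j.
    apply (prob_ge_const _ _ _ _ (pm_prob _ _ j (tri_prob tau Ht))); intros; apply powp_ge0. }
  assert (0 <= C * (tau * B n)) by (apply Rmult_le_pos; assumption).
  assert (K * tau * B n = K * (tau * B n)) by ring.
  lra.
Qed.

(** Both averages in [sparse_rosenthal] are of midpoint convex functions, so random signs only
    enlarge them. The square function under signs is then bounded by [h] itself, the factor
    [tau^(p/2)] coming out by homogeneity. *)
Theorem hypercube_Xp (p : R) : 2 <= p -> exists C, 0 <= C /\
  forall n tau h, 0 <= tau <= 1 -> multi_affine n h -> h zeroc = 0 ->
    wsum (pm (tri tau) n) (fun x => powp (Rabs (h x)) p) <=
    C * (tau * bsum n (fun j => wsum (pm sgn n) (fun x => powp (Rabs (hdiff h j x)) p)) +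
         powp tau (p / 2) * wsum (pm sgn n) (fun x => powp (Rabs (h x)) p)).
Proof.
  intros Hp.
  destruct (sparse_rosenthal p Hp) as [C1 [HC1 H1]].
  destruct (square_function_le p Hp) as [C2 [HC2 H2]].
  exists (C1 * (1 + C2)); split; [nra|]; intros n tau h Ht Hh H0.
  eapply Rle_trans; [apply H1; assumption|].
  rewrite Rmult_assoc; apply Rmult_le_compat_l; [assumption|].
  set (E := wsum (pm sgn n) (fun x => powp (Rabs (h x)) p)).
  set (B := bsum n (fun j => wsum (pm sgn n) (fun x => powp (Rabs (hdiff h j x)) p))).
  assert (HV : wsum (pm (tri tau) n) (fun x => powp (tau * sqfun h n x) (p / 2))
               <= powp tau (p / 2) * (C2 * E)).
  { rewrite (wsum_ext _ _ (fun x => powp tau (p / 2) * powp (sqfun h n x) (p / 2)))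
      by (intros x; apply powp_mult; [lra | apply sqfun_ge0]).
    rewrite wsum_scal; apply Rmult_le_compat_l; [apply powp_ge0|].
    eapply Rle_trans; [|apply H2; assumption].
    apply midconvex_mono; [assumption | apply sqfun_pow_midconvex; [lra | assumption]]. }
  (* The [j]-th difference is averaged over the first [j] coordinates only; after these become
     signs, the remaining ones are added. *)
  assert (HB : bsum n (fun j => wsum (pm (tri tau) j) (fun x => powp (Rabs (hdiff h j x)) p)) <= B).
  { apply bsum_le; intros j Hj.
    assert (Hc : midconvex n (fun x => powp (Rabs (hdiff h j x)) p))
      by (apply hdiff_pow_midconvex; [lra | assumption]).
    eapply Rle_trans; [apply midconvex_mono; [assumption | intros x i Hi; apply Hc; lia]|].
    replace n with (j + (n - j))%nat by lia.
    apply midconvex_dim_mono; replace (j + (n - j))%nat with n by lia; assumption. }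
  assert (HB0 : 0 <= B).
  { apply bsum_ge0; intros j.
    apply (prob_ge_const _ _ _ _ (pm_prob _ _ n sgn_prob)); intros; apply powp_ge0. }
  assert (HE : 0 <= powp tau (p / 2) * E).
  { apply Rmult_le_pos; [apply powp_ge0|].
    apply (prob_ge_const _ _ _ _ (pm_prob _ _ n sgn_prob)); intros; apply powp_ge0. }
  assert (S1 : tau * bsum n (fun j => wsum (pm (tri tau) j) (fun x => powp (Rabs (hdiff h j x)) p))
    <= tau * B) by (apply Rmult_le_compat_l; lra).
  assert (0 <= C2 * (tau * B)) by (apply Rmult_le_pos; [|apply Rmult_le_pos]; lra).
  lra.
Qed.

(** * The metric inequality on the discrete torus *)

Definition unif {A : Type} (m : nat) (g : nat -> A) : list (R * A) :=
  map (fun i => (/ INR m, g i)) (seq 0 m).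

Lemma wsum_unif {A : Type} (m : nat) (g : nat -> A) (G : A -> R) :
  wsum (unif m g) G = / INR m * bsum m (fun i => G (g i)).
Proof.
  unfold unif; generalize (/ INR m); intros c.
  induction m as [|m IH]; [simpl; ring|].
  rewrite seq_S, map_app, wsum_app, IH; simpl; ring.
Qed.

Lemma unif_prob {A : Type} (m : nat) (g : nat -> A) : (0 < m)%nat -> prob (unif m g) (fun _ => True).
Proof.
  intros Hm; assert (0 < INR m) by (apply lt_0_INR; assumption); split.
  - apply Forall_forall; intros a Ha; apply in_map_iff in Ha.
    destruct Ha as [i [<- _]]; simpl; split; [left; apply Rinv_0_lt_compat; assumption | exact I].
  - rewrite wsum_unif, bsum_const; field; lra.
Qed.

Definition uni (M : nat) : list (R * Z) := unif M Z.of_nat.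

Lemma uni_prob (M : nat) : (0 < M)%nat -> prob (uni M) (fun _ => True).
Proof. apply unif_prob. Qed.

(** A shift by one changes the sum over a period by the difference of two values one period apart,
    which is 0. A general [a] is replaced by its residue, so that natural shifts suffice. *)
Lemma uni_shift (M : nat) (G : Z -> R) (a : Z) : (0 < M)%nat ->
  (forall v w, (Z.of_nat M | v - w)%Z -> G v = G w) ->
  wsum (uni M) (fun v => G (v + a)%Z) = wsum (uni M) G.
Proof.
  intros HM HG.
  assert (Hn : forall k : nat,
    wsum (uni M) (fun v => G (v + Z.of_nat k)%Z) = wsum (uni M) G).
  { induction k as [|k IH].
    - apply wsum_ext; intros v; f_equal; lia.
    - rewrite <- IH; unfold uni; rewrite !wsum_unif; f_equal.
      assert (T : forall N, bsum N (fun i => G (Z.of_nat i + Z.of_nat (S k))%Z) =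
        bsum N (fun i => G (Z.of_nat i + Z.of_nat k)%Z)
        + G (Z.of_nat N + Z.of_nat k)%Z - G (Z.of_nat k)).
      { induction N as [|N IHN]; [simpl; ring|].
        rewrite !bsum_S, IHN.
        replace (Z.of_nat N + Z.of_nat (S k))%Z with (Z.of_nat (S N) + Z.of_nat k)%Z by lia; ring. }
      rewrite T, (HG (Z.of_nat M + Z.of_nat k)%Z (Z.of_nat k)); [ring|].
      exists 1%Z; lia. }
  rewrite <- (Hn (Z.to_nat (a mod Z.of_nat M))).
  apply wsum_ext; intros v; apply HG.
  pose proof (Z.mod_pos_bound a (Z.of_nat M) ltac:(lia)).
  rewrite Z2Nat.id by lia.
  exists (a / Z.of_nat M)%Z; rewrite (Z.mod_eq a) by lia; ring.
Qed.

Definition cadd (x y : cfg) : cfg := fun i => (x i + y i)%Z.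

Definition csub (x y : cfg) : cfg := fun i => (x i - y i)%Z.

Definition cscal (k : Z) (x : cfg) : cfg := fun i => (k * x i)%Z.

(** Functions on the torus Z_M^n are represented by functions of configurations that factor through
    reduction mod [M] of the first [n] coordinates. *)
Definition resp {B : Type} (n M : nat) (f : cfg -> B) : Prop :=
  forall x y, (forall i, (i < n)%nat -> (Z.of_nat M | x i - y i)%Z) -> f x = f y.

Lemma pm_shift (n M : nat) (G : cfg -> R) (y : cfg) : (0 < M)%nat -> resp n M G ->
  wsum (pm (uni M) n) (fun x => G (cadd x y)) = wsum (pm (uni M) n) G.
Proof.
  intros HM; revert G; induction n as [|n IH]; intros G HG.
  - rewrite !wsum_pm_0; apply HG; intros; lia.
  - rewrite !wsum_pm_S.
    rewrite <- (IH (fun x => wsum (uni M) (fun v => G (upd x n v)))).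
    + apply wsum_ext; intros x.
      rewrite <- (uni_shift M (fun v => G (upd (cadd x y) n v)) (y n) HM).
      * apply wsum_ext; intros v; f_equal; unfold cadd; cfg_ext.
      * intros v w Hvw; apply HG; intros i Hi; unfold upd.
        destruct (Nat.eq_dec i n); [assumption | rewrite Z.sub_diag; apply Z.divide_0_r].
    + intros x z Hxz; apply wsum_ext; intros v; apply HG; intros i Hi; unfold upd.
      destruct (Nat.eq_dec i n); [rewrite Z.sub_diag; apply Z.divide_0_r | apply Hxz; lia].
Qed.

(** Here [d] fills the zero entries of [e]; with [off] below, [mix e d = e + off e d]. Averaging
    over random signs [d] produces the multi-affine extension. *)
Definition mix (e d : cfg) : cfg := fun i => if Z.eq_dec (e i) 0 then d i else e i.

Definition off (e d : cfg) : cfg := fun i => if Z.eq_dec (e i) 0 then d i else 0%Z.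

(** When [e j = 0], the redrawn sign [d j] takes the place of a random [e j]. *)
Lemma mix_multi_affine (n : nat) (g : cfg -> R) :
  multi_affine n (fun e => wsum (pm sgn n) (fun d => g (mix e d))).
Proof.
  intros e j Hj.
  rewrite (pm_resample sgn tern n j _ sgn_prob Hj).
  unfold Rdiv; rewrite <- wsum_plus, Rmult_comm, <- wsum_scal.
  apply wsum_ext; intros d; rewrite wsum_sgn.
  assert (E : forall v, v <> 0%Z -> mix (upd e j 0) (upd d j v) = mix (upd e j v) d).
  { intros v Hv; extensionality i; unfold mix, upd.
    destruct (Nat.eq_dec i j); [destruct (Z.eq_dec v 0); [lia | reflexivity] | reflexivity]. }
  rewrite !E by lia; field.
Qed.

Definition far_term (m n M : nat) (tau : R) (Phi : cfg -> cfg -> R) : R :=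
  wsum (pm (uni M) n) (fun x => wsum (pm (tri tau) n) (fun e =>
    Phi (cadd x (cscal (2 * Z.of_nat m) e)) x)).

(** Two edges appear because the cube inequality is applied to [f (x + .) - f (x - .)], whose [j]-th
    difference involves an edge at each of the two places. *)
Definition edge_term (n M j : nat) (Phi : cfg -> cfg -> R) : R :=
  wsum (pm (uni M) n) (fun x => wsum (pm sgn n) (fun e => wsum (pm sgn n) (fun d =>
    Phi (cadd x (mix (upd e j 1) d)) (cadd x (mix (upd e j (-1)) d)) +
    Phi (csub x (mix (upd e j 1) d)) (csub x (mix (upd e j (-1)) d))))).

Definition diag_term (n M : nat) (Phi : cfg -> cfg -> R) : R :=
  wsum (pm (uni M) n) (fun x => wsum (pm sgn n) (fun e => wsum (pm sgn n) (fun d =>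
    Phi (cadd x (mix e d)) (csub x (mix e d))))).

Definition near_term (n M : nat) (tau : R) (Phi : cfg -> cfg -> R) : R :=
  wsum (pm (uni M) n) (fun x => wsum (pm (tri tau) n) (fun e => wsum (pm sgn n) (fun d =>
    Phi (cadd x (off e d)) x))).

(** Both sides are linear in [Phi]; this is what allows the passage from scalars to L_p. *)
Definition Xp_ineq (p K : R) (m n M : nat) (tau : R) (Phi : cfg -> cfg -> R) : Prop :=
  far_term m n M tau Phi <=
  K * (powp (INR m) p * (tau * bsum n (fun j => edge_term n M j Phi)
                         + powp tau (p / 2) * diag_term n M Phi)
       + near_term n M tau Phi).

(** A smoothing of [f] in the directions where [e] vanishes. It differs from [f] by at most a near
    term, and it makes the cube differences depend on a displacement along [e] alone. *)
Definition offmean (n : nat) (f : cfg -> R) (e x : cfg) : R :=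
  wsum (pm sgn n) (fun d => f (cadd x (off e d))).

Lemma offmean_resp (n M : nat) (f : cfg -> R) (e : cfg) : resp n M f -> resp n M (offmean n f e).
Proof.
  intros Hf x y Hxy; apply wsum_ext; intros d; apply Hf; intros i Hi; unfold cadd.
  replace (x i + off e d i - (y i + off e d i))%Z with (x i - y i)%Z by ring; auto.
Qed.

(* Flipping [d] turns the second average into one over [x - e + off e d]. *)
Lemma mix_mean_diff (n : nat) (f : cfg -> R) (x e : cfg) :
  wsum (pm sgn n) (fun d => f (cadd x (mix e d)) - f (csub x (mix e d))) =
  offmean n f e (cadd x e) - offmean n f e (csub x e).
Proof.
  rewrite wsum_minus; f_equal; [|f_equal].
  - apply wsum_ext; intros d; f_equal; extensionality i; unfold cadd, mix, off.
    destruct (Z.eq_dec (e i) 0); lia.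
  - rewrite <- pm_sgn_opp; apply wsum_ext; intros d; f_equal; extensionality i.
    unfold cadd, csub, mix, off, cfg_opp; destruct (Z.eq_dec (e i) 0); lia.
Qed.

Lemma power_mean_bsum (m : nat) (p : R) (d : nat -> R) : (0 < m)%nat -> 1 <= p ->
  powp (Rabs (bsum m d)) p <=
  powp (INR m) p * (/ INR m * bsum m (fun i => powp (Rabs (d i)) p)).
Proof.
  intros Hm Hp; assert (0 < INR m) by (apply lt_0_INR; assumption).
  pose proof (prob_jensen_Rabs (unif m (fun i => i)) _ d p Hp (unif_prob m _ Hm)) as J.
  rewrite !wsum_unif in J.
  replace (bsum m d) with (INR m * (/ INR m * bsum m d)) by (field; lra).
  rewrite Rabs_mult, powp_mult by apply Rabs_pos.
  rewrite (Rabs_pos_eq (INR m)) by lra.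
  apply Rmult_le_compat_l; [apply powp_ge0 | exact J].
Qed.

Lemma bsum_telescope (m : nat) (a : nat -> R) : bsum m (fun i => a (S i) - a i) = a m - a O.
Proof. induction m as [|m IH]; simpl; [ring | rewrite IH; ring]. Qed.

(** The displacement is cut into [m] steps of [2 e], the [i]-th one centred at [x + (2 i + 1) e]. By
    translation invariance all steps have the same mean cost, and the power mean inequality
    contributes [m^p]. *)
Lemma telescope_torus (n M m : nat) (p : R) (Q : cfg -> R) (e : cfg) :
  (0 < M)%nat -> (0 < m)%nat -> 1 <= p -> resp n M Q ->
  wsum (pm (uni M) n) (fun x => powp (Rabs (Q (cadd x (cscal (2 * Z.of_nat m) e)) - Q x)) p) <=
  powp (INR m) p * wsum (pm (uni M) n) (fun x => powp (Rabs (Q (cadd x e) - Q (csub x e))) p).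
Proof.
  intros HM Hm Hp HQ; assert (0 < INR m) by (apply lt_0_INR; assumption).
  set (a := fun x i => Q (cadd x (cscal (2 * Z.of_nat i) e))).
  set (G := fun x => powp (Rabs (Q (cadd x e) - Q (csub x e))) p).
  assert (HG : resp n M G).
  { intros x y Hxy; unfold G.
    rewrite (HQ (cadd x e) (cadd y e)), (HQ (csub x e) (csub y e)); [reflexivity | |];
      intros i Hi; specialize (Hxy i Hi); unfold cadd, csub.
    - replace (x i - e i - (y i - e i))%Z with (x i - y i)%Z by ring; assumption.
    - replace (x i + e i - (y i + e i))%Z with (x i - y i)%Z by ring; assumption. }
  apply Rle_trans with (wsum (pm (uni M) n) (fun x => powp (INR m) p *
    (/ INR m * bsum m (fun i => powp (Rabs (a x (S i) - a x i)) p)))).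
  - apply (prob_le _ _ _ _ (pm_prob _ _ n (uni_prob M HM))); intros x _.
    eapply Rle_trans; [|apply power_mean_bsum; assumption].
    right; f_equal; f_equal; rewrite bsum_telescope; unfold a; f_equal.
    do 2 f_equal; extensionality i; unfold cadd, cscal; lia.
  - rewrite !wsum_scal, wsum_bsum; right; f_equal.
    rewrite (bsum_ext m _ (fun _ => wsum (pm (uni M) n) G)).
    + rewrite bsum_const; field; lra.
    + intros i _; rewrite <- (pm_shift n M G (cscal (2 * Z.of_nat i + 1) e) HM HG).
      apply wsum_ext; intros x; unfold G, a.
      replace (cadd (cadd x (cscal (2 * Z.of_nat i + 1) e)) e)
        with (cadd x (cscal (2 * Z.of_nat (S i)) e))
        by (extensionality k; unfold cadd, cscal; lia).
      replace (csub (cadd x (cscal (2 * Z.of_nat i + 1) e)) e)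
        with (cadd x (cscal (2 * Z.of_nat i) e))
        by (extensionality k; unfold cadd, csub, cscal; lia).
      reflexivity.
Qed.

Lemma powp_half_diff (a b p : R) : 1 <= p ->
  powp (Rabs ((a - b) / 2)) p <= powp (Rabs a) p + powp (Rabs b) p.
Proof.
  intros Hp.
  apply Rle_trans with (powp ((Rabs a + Rabs b) / 2) p).
  - apply powp_le; [lra|]; unfold Rdiv; rewrite Rabs_mult, (Rabs_pos_eq (/ 2)) by lra.
    apply Rmult_le_compat_r; [lra|]; unfold Rminus.
    rewrite <- (Rabs_Ropp b); apply Rabs_triang.
  - pose proof (powp_midpoint (Rabs a) (Rabs b) p Hp (Rabs_pos _) (Rabs_pos _)).
    pose proof (powp_ge0 (Rabs a) p); pose proof (powp_ge0 (Rabs b) p); lra.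
Qed.

(** Insert the smoothing [Q = offmean n f e] at both ends: the errors [Q - f] are near terms, and
    the displacement of [Q] telescopes into copies of [Q (x + e) - Q (x - e)]. As a function of [e],
    the latter is the multi-affine [h x e], to which the cube inequality applies. The three pieces
    give [3^p]; the two near errors and the cube constant give [2 + C]. *)
Theorem torus_Xp (p : R) : 2 <= p -> exists K, 0 <= K /\
  forall (m n M : nat) (tau : R) (f : cfg -> R), (0 < m)%nat -> (0 < M)%nat -> 0 <= tau <= 1 ->
    resp n M f -> Xp_ineq p K m n M tau (fun y z => powp (Rabs (f y - f z)) p).
Proof.
  intros Hp; destruct (hypercube_Xp p Hp) as [C [HC HX]].
  assert (P3 : 0 <= powp 3 p) by apply powp_ge0.
  exists (powp 3 p * (2 + C)); split; [nra|].
  intros m n M tau f Hm HM Ht Hf; unfold Xp_ineq.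
  set (Phi := fun y z => powp (Rabs (f y - f z)) p).
  set (h := fun x e => wsum (pm sgn n) (fun d => f (cadd x (mix e d)) - f (csub x (mix e d)))).
  assert (Pu := pm_prob _ _ n (uni_prob M HM)).
  assert (Ps := pm_prob _ _ n sgn_prob).
  assert (Pt := pm_prob _ _ n (tri_prob tau Ht)).
  assert (Haff : forall x, multi_affine n (h x)).
  { intros x; exact (mix_multi_affine n (fun y => f (cadd x y) - f (csub x y))). }
  assert (H0 : forall x, h x zeroc = 0).
  (* At [e = 0] the averages over [x + d] and [x - d] agree, since [d] and [-d] have the same
     law. *)
  { intros x; unfold h; rewrite mix_mean_diff; apply Rminus_diag_eq; f_equal. }
  assert (Hcube : wsum (pm (uni M) n) (fun x => wsum (pm (tri tau) n) (fun e => powp (Rabs (h x e)) p))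
    <= C * (tau * bsum n (fun j => edge_term n M j Phi) + powp tau (p / 2) * diag_term n M Phi)).
  { eapply Rle_trans; [eapply (prob_le _ _ _ _ Pu); intros x _;
                         apply (HX n tau (h x) Ht (Haff x) (H0 x))|].
    rewrite wsum_scal, wsum_plus, !wsum_scal, wsum_bsum.
    apply Rmult_le_compat_l; [assumption|]; apply Rplus_le_compat.
    - apply Rmult_le_compat_l; [lra|]; apply bsum_le; intros j _; unfold edge_term.
      apply (prob_le _ _ _ _ Pu); intros x _; apply (prob_le _ _ _ _ Ps); intros e _.
      apply Rle_trans with (powp (Rabs (wsum (pm sgn n) (fun d =>
        ((f (cadd x (mix (upd e j 1) d)) - f (cadd x (mix (upd e j (-1)) d)))
         - (f (csub x (mix (upd e j 1) d)) - f (csub x (mix (upd e j (-1)) d)))) / 2))) p).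
      + right; do 2 f_equal; unfold hdiff, h, Rdiv; rewrite <- wsum_minus.
        rewrite Rmult_comm, <- wsum_scal; apply wsum_ext; intros d; ring.
      + eapply Rle_trans; [apply (prob_jensen_Rabs _ _ _ p ltac:(lra) Ps)|].
        apply (prob_le _ _ _ _ Ps); intros d _; apply powp_half_diff; lra.
    - apply Rmult_le_compat_l; [apply powp_ge0|]; unfold diag_term.
      apply (prob_le _ _ _ _ Pu); intros x _; apply (prob_le _ _ _ _ Ps); intros e _.
      apply (prob_jensen_Rabs _ _ _ p ltac:(lra) Ps). }
  set (nr := fun e => wsum (pm (uni M) n) (fun x =>
    wsum (pm sgn n) (fun d => Phi (cadd x (off e d)) x))).
  assert (Hnear : forall e, wsum (pm (uni M) n) (fun x => powp (Rabs (offmean n f e x - f x)) p) <= nr e).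
  { intros e; apply (prob_le _ _ _ _ Pu); intros x _.
    apply Rle_trans with (powp (Rabs (wsum (pm sgn n) (fun d => f (cadd x (off e d)) - f x))) p).
    - right; do 2 f_equal; rewrite wsum_minus, (prob_const _ _ _ Ps); reflexivity.
    - apply (prob_jensen_Rabs _ _ _ p ltac:(lra) Ps). }
  assert (Hfar : forall e, wsum (pm (uni M) n) (fun x => Phi (cadd x (cscal (2 * Z.of_nat m) e)) x)
    <= powp 3 p * (2 * nr e + powp (INR m) p *
         wsum (pm (uni M) n) (fun x => powp (Rabs (h x e)) p))).
  { intros e; set (Q := offmean n f e).
    assert (HQ : resp n M Q) by (apply offmean_resp; assumption).
    pose proof (telescope_torus n M m p Q e HM Hm ltac:(lra) HQ) as T.
    set (y := cscal (2 * Z.of_nat m) e) in *.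
    assert (S : wsum (pm (uni M) n) (fun x => powp (Rabs (Q (cadd x y) - f (cadd x y))) p) <= nr e).
    { rewrite (pm_shift n M (fun x => powp (Rabs (Q x - f x)) p) y HM); [apply Hnear|].
      intros a b Hab; rewrite (HQ a b Hab), (Hf a b Hab); reflexivity. }
    rewrite (wsum_ext _ (fun x => powp (Rabs (h x e)) p)
      (fun x => powp (Rabs (Q (cadd x e) - Q (csub x e))) p))
      by (intros x; unfold h; rewrite mix_mean_diff; reflexivity).
    apply Rle_trans with (wsum (pm (uni M) n) (fun x => powp 3 p *
      (powp (Rabs (Q (cadd x y) - f (cadd x y))) p + powp (Rabs (Q (cadd x y) - Q x)) p
       + powp (Rabs (Q x - f x)) p))).
    - apply (prob_le _ _ _ _ Pu); intros x _; unfold Phi.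
      eapply Rle_trans; [|apply powp_add3; try apply Rabs_pos; lra].
      apply powp_le; [lra|].
      unfold Rabs; repeat destruct (Rcase_abs _); lra.
    - rewrite wsum_scal, !wsum_plus; apply Rmult_le_compat_l; [assumption|].
      specialize (Hnear e); fold Q in Hnear; lra. }
  unfold far_term; rewrite wsum_swap.
  eapply Rle_trans; [eapply (prob_le _ _ _ _ Pt); intros e _; apply Hfar|].
  rewrite wsum_scal, wsum_plus, !wsum_scal, wsum_swap.
  replace (wsum (pm (tri tau) n) nr) with (near_term n M tau Phi)
    by (unfold near_term, nr; rewrite wsum_swap; reflexivity).
  assert (N0 : 0 <= near_term n M tau Phi).
  { apply (prob_ge_const _ _ _ _ Pu); intros x _; apply (prob_ge_const _ _ _ _ Pt); intros e _.
    apply (prob_ge_const _ _ _ _ Ps); intros d _; apply powp_ge0. }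
  set (R1 := tau * bsum n (fun j => edge_term n M j Phi) + powp tau (p / 2) * diag_term n M Phi) in *.
  assert (R0 : 0 <= R1).
  { unfold R1; apply Rplus_le_le_0_compat; apply Rmult_le_pos; try apply powp_ge0; try lra.
    - apply bsum_ge0; intros j; apply (prob_ge_const _ _ _ _ Pu); intros x _.
      apply (prob_ge_const _ _ _ _ Ps); intros e _; apply (prob_ge_const _ _ _ _ Ps); intros d _.
      apply Rplus_le_le_0_compat; apply powp_ge0.
    - apply (prob_ge_const _ _ _ _ Pu); intros x _; apply (prob_ge_const _ _ _ _ Ps); intros e _.
      apply (prob_ge_const _ _ _ _ Ps); intros d _; apply powp_ge0. }
  rewrite Rmult_assoc; apply Rmult_le_compat_l; [assumption|].
  assert (Mp : 0 <= powp (INR m) p) by apply powp_ge0.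
  apply (Rmult_le_compat_l (powp (INR m) p)) in Hcube; [|assumption].
  assert (0 <= powp (INR m) p * R1) by (apply Rmult_le_pos; assumption).
  assert (0 <= C * near_term n M tau Phi) by (apply Rmult_le_pos; assumption).
  nra.
Qed.

(** * From scalars to L_p *)

(* Common interface of "t-integral" and "sequential limit", the two operations under which the
   inequality is transported. *)
Definition pos_linear {T : Type} (Rel : (T -> R) -> R -> Prop) (D : T -> Prop) : Prop :=
  Rel (fun _ => 0) 0 /\
  (forall u v a b, Rel u a -> Rel v b -> Rel (fun t => u t + v t) (a + b)) /\
  (forall c u a, Rel u a -> Rel (fun t => c * u t) (c * a)) /\
  (forall u v a b, Rel u a -> Rel v b -> (forall t, D t -> u t <= v t) -> a <= b).

Lemma pos_linear_wsum {T A : Type} (Rel : (T -> R) -> R -> Prop) (D : T -> Prop)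
  (mu : list (R * A)) (g : T -> A -> R) (I : A -> R) : pos_linear Rel D ->
  (forall a, Rel (fun t => g t a) (I a)) -> Rel (fun t => wsum mu (g t)) (wsum mu I).
Proof.
  intros [H0 [H1 [H2 _]]] Hg; induction mu as [|a mu IH]; simpl; [exact H0|].
  apply H1; [apply H2; apply Hg | exact IH].
Qed.

Lemma pos_linear_bsum {T : Type} (Rel : (T -> R) -> R -> Prop) (D : T -> Prop)
  (n : nat) (g : T -> nat -> R) (I : nat -> R) : pos_linear Rel D ->
  (forall j, Rel (fun t => g t j) (I j)) -> Rel (fun t => bsum n (g t)) (bsum n I).
Proof.
  intros [H0 [H1 _]] Hg; induction n as [|n IH]; simpl; [exact H0|].
  apply H1; [exact IH | apply Hg].
Qed.

Lemma Xp_ineq_pos_linear {T : Type} (Rel : (T -> R) -> R -> Prop) (D : T -> Prop)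
  (p K : R) (m n M : nat) (tau : R) (Phi : T -> cfg -> cfg -> R) (I : cfg -> cfg -> R) :
  pos_linear Rel D -> (forall y z, Rel (fun t => Phi t y z) (I y z)) ->
  (forall t, D t -> Xp_ineq p K m n M tau (Phi t)) -> Xp_ineq p K m n M tau I.
Proof.
  intros HR HP HX; pose proof HR as [_ [H1 [H2 H3]]].
  refine (H3 (fun t => far_term m n M tau (Phi t)) (fun t => K *
    (powp (INR m) p * (tau * bsum n (fun j => edge_term n M j (Phi t))
                       + powp tau (p / 2) * diag_term n M (Phi t))
       + near_term n M tau (Phi t))) _ _ _ _ HX).
  - do 2 (apply (pos_linear_wsum Rel D); [exact HR | intros ?]); apply HP.
  - apply H2, H1; [apply H2, H1; apply H2|].
    + apply (pos_linear_bsum Rel D); [exact HR | intros j].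
      do 3 (apply (pos_linear_wsum Rel D); [exact HR | intros ?]); apply H1; apply HP.
    + do 3 (apply (pos_linear_wsum Rel D); [exact HR | intros ?]); apply HP.
    + do 3 (apply (pos_linear_wsum Rel D); [exact HR | intros ?]); apply HP.
Qed.

Lemma pos_linear_RInt :
  pos_linear (fun u l => is_RInt u 0 1 l) (fun t => 0 < t < 1).
Proof.
  repeat split.
  - pose proof (is_RInt_const 0 1 (0 : R)) as H.
    unfold scal in H; simpl in H; unfold mult in H; simpl in H.
    rewrite Rmult_0_r in H; exact H.
  - intros u v a b Hu Hv; exact (is_RInt_plus u v 0 1 a b Hu Hv).
  - intros c u a Hu; exact (is_RInt_scal u 0 1 c a Hu).
  - intros u v a b Hu Hv H; apply (is_RInt_le u v 0 1); auto; lra.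
Qed.

Lemma pos_linear_lim :
  pos_linear (fun (u : nat -> R) (l : R) => is_lim_seq u l) (fun _ => True).
Proof.
  repeat split.
  - apply is_lim_seq_const.
  - intros u v a b Hu Hv; apply (is_lim_seq_plus' u v a b Hu Hv).
  - intros c u a Hu; exact (is_lim_seq_scal_l u c a Hu).
  - intros u v a b Hu Hv H.
    exact (is_lim_seq_le u v a b (fun n => H n I) Hu Hv).
Qed.

(** * Continuity of powers and the p-norm distance *)

Lemma powp_lipschitz_ordered (u v B r : R) : 1 <= r -> 0 <= v -> v <= u -> u <= B ->
  0 <= powp u r - powp v r <= r * powp B (r - 1) * (u - v).
Proof.
  intros Hr Hv Hvu Hu; split.
  - assert (powp v r <= powp u r) by (apply powp_le; lra); lra.
  - eapply Rle_trans; [apply powp_diff_le; lra|].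
    apply Rmult_le_compat_r; [lra|]; apply Rmult_le_compat_l; [lra | apply powp_le; lra].
Qed.

Lemma powp_lipschitz (u v B r : R) : 1 <= r -> 0 <= u <= B -> 0 <= v <= B ->
  Rabs (powp u r - powp v r) <= r * powp B (r - 1) * Rabs (u - v).
Proof.
  intros Hr Hu Hv; destruct (Rle_dec v u) as [H|H].
  - pose proof (powp_lipschitz_ordered u v B r Hr); rewrite !Rabs_pos_eq; lra.
  - pose proof (powp_lipschitz_ordered v u B r Hr).
    rewrite (Rabs_minus_sym (powp u r)), (Rabs_minus_sym u); rewrite !Rabs_pos_eq; lra.
Qed.

Lemma powp_Rabs_continuous (r x : R) : 1 <= r -> continuity_pt (fun y => powp (Rabs y) r) x.
Proof.
  intros Hr e He.
  set (B := Rabs x + 1); set (L := r * powp B (r - 1) + 1).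
  assert (HL : 0 < L) by (unfold L; pose proof (powp_ge0 B (r - 1)); nra).
  exists (Rmin 1 (e / L)); split.
  { apply Rmin_pos; [lra | apply Rdiv_lt_0_compat; lra]. }
  intros y [_ Hy]; simpl in *; unfold R_dist in *.
  assert (Hy1 : Rabs (y - x) < 1) by (eapply Rlt_le_trans; [exact Hy | apply Rmin_l]).
  assert (Hy2 : Rabs (y - x) < e / L) by (eapply Rlt_le_trans; [exact Hy | apply Rmin_r]).
  pose proof (Rabs_triang_inv y x) as T1; pose proof (Rabs_triang_inv2 y x) as T2.
  eapply Rle_lt_trans; [apply (powp_lipschitz _ _ B); try assumption|].
  - split; [apply Rabs_pos | unfold B; lra].
  - split; [apply Rabs_pos | unfold B; lra].
  - apply Rle_lt_trans with (L * Rabs (y - x)).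
    + apply Rmult_le_compat; try apply Rabs_pos; try assumption; unfold L; [|lra].
      apply Rmult_le_pos; [lra | apply powp_ge0].
    + apply Rlt_le_trans with (L * (e / L)); [apply Rmult_lt_compat_l; assumption|].
      right; field; lra.
Qed.

Definition cont01 (f : R -> R) : Prop := forall x, 0 <= x <= 1 -> continuity_pt f x.

Lemma cont01_ex_RInt (f : R -> R) : cont01 f -> ex_RInt f 0 1.
Proof.
  intros Hf; apply (ex_RInt_continuous (V := R_CompleteNormedModule)); intros x.
  rewrite Rmin_left, Rmax_right by lra; intros Hx.
  apply continuity_pt_filterlim; auto.
Qed.

Lemma cont01_powp_diff (p : R) (f g : R -> R) : 1 <= p -> cont01 f -> cont01 g ->
  cont01 (fun x => powp (Rabs (f x - g x)) p).
Proof.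
  intros Hp Hf Hg x Hx.
  apply (continuity_pt_comp (fun y => f y - g y) (fun y => powp (Rabs y) p)).
  - apply continuity_pt_minus; auto.
  - apply powp_Rabs_continuous; assumption.
Qed.

Lemma Rint01_RInt (f : R -> R) : ex_RInt f 0 1 -> Rint01 f = RInt f 0 1.
Proof.
  intros Hf; unfold Rint01.
  destruct (epsilon_spec (inhabits 0)
    (fun I => exists pr : Riemann_integrable f 0 1, RiemannInt pr = I)) as [pr <-].
  - exists (RiemannInt (ex_RInt_Reals_0 _ _ _ Hf)), (ex_RInt_Reals_0 _ _ _ Hf); reflexivity.
  - symmetry; apply RInt_Reals.
Qed.

Lemma lpd_ge0 (p : R) (f g : R -> R) : 0 <= lpd p f g.
Proof. apply powp_ge0. Qed.

Lemma lpd_is_RInt (p : R) (f g : R -> R) : 1 <= p -> cont01 f -> cont01 g ->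
  is_RInt (fun x => powp (Rabs (f x - g x)) p) 0 1 (powp (lpd p f g) p).
Proof.
  intros Hp Hf Hg.
  assert (E : ex_RInt (fun x => powp (Rabs (f x - g x)) p) 0 1)
    by (apply cont01_ex_RInt, cont01_powp_diff; assumption).
  replace (powp (lpd p f g) p) with (RInt (fun x => powp (Rabs (f x - g x)) p) 0 1).
  - apply (RInt_correct (V := R_CompleteNormedModule)); exact E.
  - unfold lpd; rewrite Rint01_RInt, powp_powp by exact E.
    rewrite Rinv_l by lra; symmetry; apply powp_1.
    apply RInt_ge_0; [lra | exact E | intros; apply powp_ge0].
Qed.

(** [(u + v) / (a + b)] is the convex combination of [u / a] and [v / b] with weights [a / (a + b)]
    and [b / (a + b)]. *)
Lemma powp_convex_sum (a b u v p : R) : 1 <= p -> 0 < a -> 0 < b -> 0 <= u -> 0 <= v ->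
  powp (u + v) p <=
  powp (a + b) p * (a / (a + b) * (/ powp a p * powp u p) + b / (a + b) * (/ powp b p * powp v p)).
Proof.
  intros Hp Ha Hb Hu Hv.
  assert (Q : forall c w, 0 < c -> 0 <= w -> / powp c p * powp w p = powp (w / c) p).
  { intros c w Hc Hw; assert (0 < powp c p) by (apply powp_gt0; assumption).
    assert (0 <= w / c) by (apply Rdiv_le_0_compat; assumption).
    apply (Rmult_eq_reg_l (powp c p)); [|lra].
    rewrite <- powp_mult, <- Rmult_assoc, Rinv_r, Rmult_1_l by lra; f_equal; field; lra. }
  rewrite !Q by assumption.
  assert (0 <= u / a) by (apply Rdiv_le_0_compat; assumption).
  assert (0 <= v / b) by (apply Rdiv_le_0_compat; assumption).
  set (mu := [(a / (a + b), u / a); (b / (a + b), v / b)]).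
  assert (Hmu : prob mu (fun _ => True)).
  { split; [|simpl; field; lra].
    repeat apply Forall_cons; try apply Forall_nil; simpl; split; auto; left;
      apply Rdiv_lt_0_compat; lra. }
  pose proof (prob_jensen mu _ (fun w => Rabs w) p Hp Hmu (fun w => Rabs_pos w)) as J.
  simpl in J; rewrite !(Rabs_pos_eq (_ / _)) in J by assumption.
  replace (u + v) with ((a + b) * (a / (a + b) * (u / a) + (b / (a + b) * (v / b) + 0)))
    by (field; lra).
  assert (0 <= a / (a + b)) by (left; apply Rdiv_lt_0_compat; lra).
  assert (0 <= b / (a + b)) by (left; apply Rdiv_lt_0_compat; lra).
  rewrite powp_mult by (try lra; repeat apply Rplus_le_le_0_compat; try lra;
                        apply Rmult_le_pos; assumption).
  apply Rmult_le_compat_l; [apply powp_ge0 | lra].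
Qed.

(** Minkowski's inequality by normalisation: integrate [powp_convex_sum]. Strict upper bounds [a],
    [b] replace the distances themselves so that the denominators are positive even when a distance
    is 0. *)
Lemma lpd_triangle_strict (p a b : R) (f g h : R -> R) :
  1 <= p -> cont01 f -> cont01 g -> cont01 h ->
  lpd p f g < a -> lpd p g h < b -> lpd p f h <= a + b.
Proof.
  intros Hp Hf Hg Hh Ha Hb.
  pose proof (lpd_ge0 p f g); pose proof (lpd_ge0 p g h).
  apply (powp_inv_le _ _ p); [lra | lra|].
  pose proof (lpd_is_RInt p f g Hp Hf Hg) as I1.
  pose proof (lpd_is_RInt p g h Hp Hg Hh) as I2.
  pose proof (lpd_is_RInt p f h Hp Hf Hh) as I3.
  destruct pos_linear_RInt as [_ [L1 [L2 L3]]].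
  assert (Pa : 0 < powp a p) by (apply powp_gt0; lra).
  assert (Pb : 0 < powp b p) by (apply powp_gt0; lra).
  eapply Rle_trans.
  - apply (L3 _ (fun t => powp (a + b) p *
      (a / (a + b) * (/ powp a p * powp (Rabs (f t - g t)) p)
       + b / (a + b) * (/ powp b p * powp (Rabs (g t - h t)) p))) _ _ I3).
    + apply L2, L1; apply L2, L2; eassumption.
    + intros t _; eapply Rle_trans; [|apply powp_convex_sum; try apply Rabs_pos; lra].
      apply powp_le; [lra|].
      replace (f t - h t) with ((f t - g t) + (g t - h t)) by ring; apply Rabs_triang.
  - assert (B : forall c d, 0 < c -> 0 <= d <= c -> / powp c p * powp d p <= 1).
    { intros c d Hc Hd; assert (0 < powp c p) by (apply powp_gt0; assumption).
      apply (Rmult_le_reg_l (powp c p)); [assumption|].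
      rewrite <- Rmult_assoc, Rinv_r, Rmult_1_l, Rmult_1_r by lra; apply powp_le; lra. }
    rewrite <- (Rmult_1_r (powp (a + b) p)) at 2.
    apply Rmult_le_compat_l; [apply powp_ge0|].
    replace 1 with (a / (a + b) * 1 + b / (a + b) * 1) by (field; lra).
    apply Rplus_le_compat; (apply Rmult_le_compat_l;
      [left; apply Rdiv_lt_0_compat; lra | apply B; lra]).
Qed.

Lemma lpd_triangle (p : R) (f g h : R -> R) : 1 <= p -> cont01 f -> cont01 g -> cont01 h ->
  lpd p f h <= lpd p f g + lpd p g h.
Proof.
  intros Hp Hf Hg Hh; apply le_epsilon; intros e He.
  replace (lpd p f g + lpd p g h + e) with ((lpd p f g + e / 2) + (lpd p g h + e / 2)) by field.
  apply (lpd_triangle_strict p _ _ f g h); auto; lra.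
Qed.

Lemma lpd_sym (p : R) (f g : R -> R) : lpd p f g = lpd p g f.
Proof.
  unfold lpd; do 2 f_equal; extensionality x; f_equal; apply Rabs_minus_sym.
Qed.

(** The triangle inequality makes the distances of the approximants a Cauchy sequence, so the limit
    chosen by [epsilon] exists. *)
Lemma Lp_dist_lim (p : R) (u v : Lp p) : 1 <= p ->
  is_lim_seq (fun n => lpd p (lp_seq u n) (lp_seq v n)) (Lp_dist p u v).
Proof.
  intros Hp.
  apply is_lim_seq_Reals; unfold Lp_dist.
  apply (epsilon_spec (inhabits 0)
    (fun d => Un_cv (fun n => lpd p (lp_seq u n) (lp_seq v n)) d)).
  destruct (Rcomplete.R_complete (fun n => lpd p (lp_seq u n) (lp_seq v n))) as [l Hl];
    [|exists l; exact Hl].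
  intros e He.
  destruct (lp_cauchy p u (e / 2) ltac:(lra)) as [N1 H1].
  destruct (lp_cauchy p v (e / 2) ltac:(lra)) as [N2 H2].
  exists (N1 + N2)%nat; intros n m Hn Hm; unfold R_dist.
  assert (Cu : forall n, cont01 (lp_seq u n)) by (intros k; exact (lp_cont p u k)).
  assert (Cv : forall n, cont01 (lp_seq v n)) by (intros k; exact (lp_cont p v k)).
  assert (B : forall n m, lpd p (lp_seq u n) (lp_seq v n) <=
    lpd p (lp_seq u n) (lp_seq u m) + lpd p (lp_seq u m) (lp_seq v m)
    + lpd p (lp_seq v m) (lp_seq v n)).
  { intros i j.
    pose proof (lpd_triangle p (lp_seq u i) (lp_seq u j) (lp_seq v i) Hp (Cu i) (Cu j) (Cv i)).
    pose proof (lpd_triangle p (lp_seq u j) (lp_seq v j) (lp_seq v i) Hp (Cu j) (Cv j) (Cv i)).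
    lra. }
  pose proof (B n m) as B1; pose proof (B m n) as B2.
  rewrite (lpd_sym p (lp_seq u m) (lp_seq u n)), (lpd_sym p (lp_seq v n) (lp_seq v m)) in B2.
  specialize (H1 n m ltac:(lia) ltac:(lia)); specialize (H2 m n ltac:(lia) ltac:(lia)).
  apply Rabs_def1; lra.
Qed.

Lemma Lp_dist_pow_lim (p : R) (u v : Lp p) : 1 <= p ->
  is_lim_seq (fun n => powp (lpd p (lp_seq u n) (lp_seq v n)) p) (powp (Lp_dist p u v) p).
Proof.
  intros Hp; pose proof (Lp_dist_lim p u v Hp) as L.
  assert (H0 : 0 <= Lp_dist p u v).
  { refine (is_lim_seq_le (fun _ => 0) _ 0 (Lp_dist p u v) _ (is_lim_seq_const 0) L).
    intros n; apply lpd_ge0. }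
  rewrite <- (Rabs_pos_eq _ H0).
  apply is_lim_seq_ext with (fun n => powp (Rabs (lpd p (lp_seq u n) (lp_seq v n))) p).
  { intros n; rewrite Rabs_pos_eq by apply lpd_ge0; reflexivity. }
  apply (is_lim_seq_continuous (fun y => powp (Rabs y) p)); [|exact L].
  apply powp_Rabs_continuous; assumption.
Qed.

(** The scalar inequality holds for the [N]-th approximants at each [t]; integrate over [t], then
    let [N] tend to infinity. *)
Lemma Lp_Xp_ineq (p : R) : 2 <= p -> exists K, 0 <= K /\
  forall (m n M : nat) (tau : R) (F : cfg -> Lp p), (0 < m)%nat -> (0 < M)%nat -> 0 <= tau <= 1 ->
    resp n M F -> Xp_ineq p K m n M tau (fun y z => powp (Lp_dist p (F y) (F z)) p).
Proof.
  intros Hp; destruct (torus_Xp p Hp) as [K [HK HX]].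
  exists K; split; [assumption|]; intros m n M tau F Hm HM Ht HF.
  apply (Xp_ineq_pos_linear _ _ _ _ _ _ _ _
    (fun N y z => powp (lpd p (lp_seq (F y) N) (lp_seq (F z) N)) p) _ pos_linear_lim).
  { intros y z; apply Lp_dist_pow_lim; lra. }
  intros N _.
  apply (Xp_ineq_pos_linear _ _ _ _ _ _ _ _
    (fun t y z => powp (Rabs (lp_seq (F y) N t - lp_seq (F z) N t)) p) _ pos_linear_RInt).
  { intros y z; apply lpd_is_RInt; [lra | exact (lp_cont p _ N) | exact (lp_cont p _ N)]. }
  intros t _.
  apply (HX m n M tau (fun y => lp_seq (F y) N t)); auto.
  intros x y Hxy; rewrite (HF x y Hxy); reflexivity.
Qed.

(** * Disjoint bumps in L_q *)

(** Twice the positive part of a parabola, positive exactly on the interval [(1/(j+2), 1/(j+1))];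
    these intervals are disjoint. *)
Definition bump (j : nat) (t : R) : R :=
  (t - / INR (j + 2)) * (/ INR (j + 1) - t) + Rabs ((t - / INR (j + 2)) * (/ INR (j + 1) - t)).

Lemma bump_ge0 (j : nat) (t : R) : 0 <= bump j t.
Proof. unfold bump, Rabs; destruct (Rcase_abs _); lra. Qed.

Lemma inv_INR_le (i j : nat) : (0 < i)%nat -> (i <= j)%nat -> / INR j <= / INR i.
Proof.
  intros; apply Rinv_le_contravar; [apply lt_0_INR; assumption | apply le_INR; assumption].
Qed.

Lemma bump_ends (j : nat) : 0 < / INR (j + 2) /\ / INR (j + 2) < / INR (j + 1) /\ / INR (j + 1) <= 1.
Proof.
  repeat split.
  - apply Rinv_0_lt_compat, lt_0_INR; lia.
  - apply Rinv_lt_contravar; [apply Rmult_lt_0_compat; apply lt_0_INR; lia | apply lt_INR; lia].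
  - rewrite <- Rinv_1; apply (inv_INR_le 1); lia.
Qed.

Lemma bump_pos (j : nat) (t : R) : / INR (j + 2) < t < / INR (j + 1) -> 0 < bump j t.
Proof.
  intros Ht; unfold bump.
  assert (0 < (t - / INR (j + 2)) * (/ INR (j + 1) - t)) by (apply Rmult_lt_0_compat; lra).
  rewrite Rabs_pos_eq; lra.
Qed.

Lemma bump_support (j : nat) (t : R) : bump j t <> 0 -> / INR (j + 2) < t < / INR (j + 1).
Proof.
  intros H; destruct (bump_ends j) as [_ [E _]].
  destruct (Rle_dec ((t - / INR (j + 2)) * (/ INR (j + 1) - t)) 0) as [Hn|Hn].
  - exfalso; apply H; unfold bump; rewrite Rabs_left1; lra.
  - split; apply Rnot_le_lt; intros C; apply Hn; nra.
Qed.

Lemma bump_disjoint (i j : nat) (t : R) : (i < j)%nat -> bump i t = 0 \/ bump j t = 0.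
Proof.
  intros Hij; destruct (Req_dec (bump i t) 0) as [|Hi]; [left; assumption | right].
  destruct (Req_dec (bump j t) 0) as [|Hj]; [assumption | exfalso].
  apply bump_support in Hi; apply bump_support in Hj.
  pose proof (inv_INR_le (i + 2) (j + 1) ltac:(lia) ltac:(lia)); lra.
Qed.

Lemma bump_continuous (j : nat) (t : R) : continuity_pt (bump j) t.
Proof.
  unfold bump; generalize (/ INR (j + 2)) (/ INR (j + 1)); intros a b.
  assert (H : continuity_pt (fun t => (t - a) * (b - t)) t) by reg.
  apply continuity_pt_plus; [exact H|].
  apply (continuity_pt_comp (fun t => (t - a) * (b - t)) Rabs); [exact H | apply Rcontinuity_abs].
Qed.

Lemma bump_pow_continuous (q : R) (j : nat) (t : R) : 1 <= q ->
  continuity_pt (fun t => powp (bump j t) q) t.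
Proof.
  intros Hq.
  replace (fun t => powp (bump j t) q) with (fun t => powp (Rabs (bump j t)) q)
    by (extensionality s; rewrite Rabs_pos_eq by apply bump_ge0; reflexivity).
  apply (continuity_pt_comp (bump j) (fun y => powp (Rabs y) q));
    [apply bump_continuous | apply powp_Rabs_continuous; assumption].
Qed.

Lemma bump_integral_pos (q : R) (j : nat) : 1 <= q ->
  0 < RInt (fun t => powp (bump j t) q) 0 1.
Proof.
  intros Hq; destruct (bump_ends j) as [E1 [E2 E3]].
  assert (C : forall t, continuous (fun t => powp (bump j t) q) t).
  { intros t; apply continuity_pt_filterlim, bump_pow_continuous; assumption. }
  assert (I : forall a b, ex_RInt (fun t => powp (bump j t) q) a b)
    by (intros a b; apply (ex_RInt_continuous (V := R_CompleteNormedModule)); auto).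
  rewrite <- (RInt_Chasles _ 0 (/ INR (j + 2)) 1) by apply I.
  rewrite <- (RInt_Chasles _ (/ INR (j + 2)) (/ INR (j + 1)) 1) by apply I.
  unfold plus; simpl.
  assert (0 <= RInt (fun t => powp (bump j t) q) 0 (/ INR (j + 2)))
    by (apply RInt_ge_0; [lra | apply I | intros; apply powp_ge0]).
  assert (0 <= RInt (fun t => powp (bump j t) q) (/ INR (j + 1)) 1)
    by (apply RInt_ge_0; [lra | apply I | intros; apply powp_ge0]).
  assert (0 < RInt (fun t => powp (bump j t) q) (/ INR (j + 2)) (/ INR (j + 1))).
  { apply RInt_gt_0; [assumption | intros; apply powp_gt0, bump_pos; assumption | intros; apply C]. }
  lra.
Qed.

Definition nbump (q : R) (j : nat) (t : R) : R :=
  powp (RInt (fun t => powp (bump j t) q) 0 1) (- / q) * bump j t.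

Lemma nbump_integral (q : R) (j : nat) : 1 <= q ->
  is_RInt (fun t => powp (nbump q j t) q) 0 1 1.
Proof.
  intros Hq; pose proof (bump_integral_pos q j Hq) as Hc.
  set (c := RInt (fun t => powp (bump j t) q) 0 1) in *.
  assert (I : is_RInt (fun t => powp (bump j t) q) 0 1 c).
  { apply (RInt_correct (V := R_CompleteNormedModule)), cont01_ex_RInt.
    intros t _; apply bump_pow_continuous; assumption. }
  assert (E : powp c (-1) * c = 1).
  { rewrite <- (powp_1 c) at 2 by lra; rewrite <- powp_plus.
    replace (-1 + 1) with 0 by ring; rewrite powp_pos by assumption; apply Rpower_O; assumption. }
  replace (fun t => powp (nbump q j t) q) with (fun t => powp c (-1) * powp (bump j t) q).
  - assert (J : is_RInt (fun t => powp c (-1) * powp (bump j t) q) 0 1 (powp c (-1) * c))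
      by exact (is_RInt_scal _ 0 1 (powp c (-1)) c I).
    rewrite E in J; exact J.
  - extensionality t; unfold nbump; fold c.
    rewrite powp_mult, powp_powp by (apply powp_ge0 || apply bump_ge0).
    do 2 f_equal; field; lra.
Qed.

Definition step_fun (q : R) (n : nat) (a : nat -> R) (t : R) : R :=
  bsum n (fun j => a j * nbump q j t).

Lemma step_fun_cont (q : R) (n : nat) (a : nat -> R) : cont01 (step_fun q n a).
Proof.
  intros t _; unfold step_fun; induction n as [|n IH]; simpl.
  - apply continuity_pt_const; intros ? ?; reflexivity.
  - apply continuity_pt_plus; [exact IH|].
    apply continuity_pt_mult; [apply continuity_pt_const; intros ? ?; reflexivity|].
    apply continuity_pt_mult; [apply continuity_pt_const; intros ? ?; reflexivity|].
    apply bump_continuous.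
Qed.

(** At each [t] at most one bump is nonzero, so the power of the sum is the sum of the powers. *)
Lemma step_fun_pow (q : R) (n : nat) (a b : nat -> R) (t : R) :
  powp (Rabs (step_fun q n a t - step_fun q n b t)) q =
  bsum n (fun j => powp (Rabs (a j - b j)) q * powp (nbump q j t) q).
Proof.
  unfold step_fun; induction n as [|n IH]; simpl.
  - rewrite Rminus_0_r, Rabs_R0; apply powp_nonpos; lra.
  - destruct (Req_dec (bump n t) 0) as [H|H].
    + assert (E : nbump q n t = 0) by (unfold nbump; rewrite H; ring).
      rewrite E, !Rmult_0_r, !Rplus_0_r, IH, (powp_nonpos 0), Rmult_0_r; lra.
    + assert (Z : forall j, (j < n)%nat -> nbump q j t = 0).
      { intros j Hj; unfold nbump.
        destruct (bump_disjoint j n t Hj) as [-> |]; [ring | contradiction]. }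
      assert (B : forall g, (forall j, (j < n)%nat -> g j = 0) -> bsum n g = 0)
        by (intros g Hg; rewrite (bsum_ext n g (fun _ => 0) Hg), bsum_const; ring).
      rewrite !B, !Rplus_0_l by
        (intros j Hj; rewrite (Z j Hj), ?(powp_nonpos 0) by lra; ring).
      rewrite <- Rmult_minus_distr_r, Rabs_mult, powp_mult by apply Rabs_pos.
      rewrite (Rabs_pos_eq (nbump q n t)); [reflexivity|].
      apply Rmult_le_pos; [apply powp_ge0 | apply bump_ge0].
Qed.

Lemma lpd_step_fun (q : R) (n : nat) (a b : nat -> R) : 1 <= q ->
  lpd q (step_fun q n a) (step_fun q n b) =
  powp (bsum n (fun j => powp (Rabs (a j - b j)) q)) (/ q).
Proof.
  intros Hq.
  rewrite <- (powp_1 (lpd _ _ _)) by apply lpd_ge0.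
  replace 1 with (q * / q) by (field; lra); rewrite <- powp_powp; f_equal.
  pose proof (lpd_is_RInt q _ _ Hq (step_fun_cont q n a) (step_fun_cont q n b)) as I.
  apply (is_RInt_unique (V := R_CompleteNormedModule)) in I; rewrite <- I.
  apply (is_RInt_unique (V := R_CompleteNormedModule)).
  replace (fun t => powp (Rabs (step_fun q n a t - step_fun q n b t)) q)
    with (fun t => bsum n (fun j => powp (Rabs (a j - b j)) q * powp (nbump q j t) q))
    by (extensionality t; symmetry; apply step_fun_pow).
  apply (pos_linear_bsum _ _ n _ _ pos_linear_RInt); intros j.
  pose proof (is_RInt_scal _ 0 1 (powp (Rabs (a j - b j)) q) 1 (nbump_integral q j Hq)) as S.
  unfold scal in S; simpl in S; unfold mult in S; simpl in S; rewrite Rmult_1_r in S; exact S.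
Qed.

(** An isometric copy of the n-dimensional l_q, spanned by normalised bumps and entering the
    completion through constant sequences. *)
Lemma Lq_contains_lq (q : R) (n : nat) : 1 <= q -> exists P : (nat -> R) -> Lp q,
  forall a b, Lp_dist q (P a) (P b) = powp (bsum n (fun j => powp (Rabs (a j - b j)) q)) (/ q).
Proof.
  intros Hq.
  assert (Hc : forall a e, e > 0 -> exists N : nat, forall k l : nat, (N <= k)%nat -> (N <= l)%nat ->
    lpd q (step_fun q n a) (step_fun q n a) < e).
  { intros a e He; exists O; intros k l _ _; rewrite lpd_step_fun by assumption.
    rewrite (bsum_ext n _ (fun _ => 0)), bsum_const, Rmult_0_r, powp_nonpos; try lra.
    intros j _; rewrite Rminus_diag, Rabs_R0; apply powp_nonpos; lra. }
  exists (fun a => MkLp q (fun _ => step_fun q n a) (fun _ => step_fun_cont q n a) (Hc a)).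
  intros a b; rewrite <- (lpd_step_fun q n a b Hq).
  match goal with |- Lp_dist q ?u ?v = _ => pose proof (Lp_dist_lim q u v Hq) as L end.
  simpl in L; apply is_lim_seq_unique in L; rewrite Lim_seq_const in L.
  injection L; intros E; symmetry; exact E.
Qed.

(** * The obstruction *)

(** The distance from [v] to the nearest multiple of [M]. *)
Definition tent (M : Z) (v : Z) : R := IZR (Z.min (v mod M) (M - v mod M)).

Lemma tent_periodic (M v w : Z) : (0 < M)%Z -> (M | v - w)%Z -> tent M v = tent M w.
Proof.
  intros HM [k Hk]; unfold tent; replace v with (w + k * M)%Z by lia.
  rewrite Z_mod_plus_full; reflexivity.
Qed.

Lemma tent_small (M v : Z) : (0 <= v)%Z -> (2 * v <= M)%Z -> (0 < M)%Z -> tent M v = IZR v.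
Proof. intros; unfold tent; rewrite Z.mod_small by lia; f_equal; lia. Qed.

Lemma tent_succ (M v : Z) : (0 < M)%Z -> Rabs (tent M (v + 1) - tent M v) <= 1.
Proof.
  intros HM; unfold tent; rewrite <- minus_IZR, <- abs_IZR; apply IZR_le.
  pose proof (Z.mod_pos_bound v M HM) as B.
  assert (E : ((v + 1) mod M = v mod M + 1)%Z \/ ((v + 1) mod M = 0 /\ v mod M = M - 1)%Z).
  { pose proof (Z.div_mod v M ltac:(lia)) as D.
    destruct (Z.eq_dec (v mod M) (M - 1)) as [H|H].
    - right; split; [|assumption].
      symmetry; apply (Z.mod_unique _ _ (v / M + 1)); lia.
    - left; symmetry; apply (Z.mod_unique _ _ (v / M)); lia. }
  destruct E as [-> | [-> ->]]; lia.
Qed.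

Lemma tent_tern (M v w : Z) : (0 < M)%Z -> tern w -> Rabs (tent M (v + w) - tent M v) <= 1.
Proof.
  intros HM Hw; unfold tern in Hw.
  assert (C : (w = 1 \/ w = 0 \/ w = -1)%Z) by lia.
  destruct C as [-> | [-> | ->]].
  - apply tent_succ; assumption.
  - rewrite Z.add_0_r, Rminus_diag, Rabs_R0; lra.
  - rewrite Rabs_minus_sym.
    pose proof (tent_succ M (v + -1) HM) as H; replace (v + -1 + 1)%Z with v in H by ring; exact H.
Qed.

Lemma tent_tern2 (M v w : Z) : (0 < M)%Z -> tern w -> Rabs (tent M (v + w) - tent M (v - w)) <= 2.
Proof.
  intros HM Hw.
  pose proof (tent_tern M v w HM Hw) as H1.
  pose proof (tent_tern M v (- w) HM ltac:(unfold tern in *; lia)) as H2.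
  replace (tent M (v + w) - tent M (v - w))
    with ((tent M (v + w) - tent M v) + (tent M v - tent M (v + - w)))
    by (replace (v + - w)%Z with (v - w)%Z by ring; ring).
  eapply Rle_trans; [apply Rabs_triang|].
  rewrite (Rabs_minus_sym (tent M v)); lra.
Qed.

Lemma bsum_split (a k : nat) (g : nat -> R) :
  bsum (a + k) g = bsum a g + bsum k (fun i => g (a + i)%nat).
Proof.
  induction k as [|k IH]; [rewrite Nat.add_0_r; simpl; ring|].
  rewrite Nat.add_succ_r, !bsum_S, IH; ring.
Qed.

Lemma bsum_block_ge (a k r : nat) (g : nat -> R) (c : R) : (forall i, 0 <= g i) ->
  (forall i, (i < k)%nat -> c <= g (a + i)%nat) -> INR k * c <= bsum (a + k + r) g.
Proof.
  intros H0 H; rewrite !bsum_split, <- bsum_const.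
  pose proof (bsum_le k _ _ H); pose proof (bsum_ge0 a g H0).
  pose proof (bsum_ge0 r (fun i => g (a + k + i)%nat) ltac:(intros; apply H0)); simpl in *; lra.
Qed.

Lemma tent_far (m : nat) (q : R) (w : Z) : (0 < m)%nat -> 0 <= q -> (w = 1 \/ w = -1)%Z ->
  powp (2 * INR m) q / 4 <=
  wsum (uni (8 * m)) (fun v => powp (Rabs (tent (Z.of_nat (8 * m)) (v + 2 * Z.of_nat m * w)
                                           - tent (Z.of_nat (8 * m)) v)) q).
Proof.
  intros Hm Hq Hw; assert (0 < INR m) by (apply lt_0_INR; assumption).
  unfold uni; rewrite wsum_unif.
  set (g := fun i => powp (Rabs (tent (Z.of_nat (8 * m)) (Z.of_nat i + 2 * Z.of_nat m * w)
                                 - tent (Z.of_nat (8 * m)) (Z.of_nat i))) q).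
  assert (E : exists a r : nat, (8 * m = a + 2 * m + r)%nat /\
    forall i, (i < 2 * m)%nat -> powp (2 * INR m) q <= g (a + i)%nat).
  { assert (V : 2 * INR m = IZR (2 * Z.of_nat m)) by (rewrite mult_IZR, <- INR_IZR_INZ; ring).
    (* On a quarter of the residues, [[0, 2m)] for [w = 1] and [[2m, 4m)] for [w = -1], both points
       stay where [tent] is the identity, so its value changes by exactly [2 m]. *)
    destruct Hw as [-> | ->]; [exists O, (6 * m)%nat | exists (2 * m)%nat, (4 * m)%nat];
      (split; [lia|]); intros i Hi; unfold g; rewrite !tent_small by lia;
      rewrite <- minus_IZR, <- abs_IZR; apply powp_le; try assumption;
      rewrite V; apply IZR_le; lia. }
  destruct E as [a [r [E Hg]]].
  pose proof (bsum_block_ge a (2 * m) r g (powp (2 * INR m) q) (fun i => powp_ge0 _ _) Hg) as B.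
  rewrite <- E in B; rewrite !mult_INR in *; simpl (INR 2) in *; simpl (INR 8).
  apply (Rmult_le_reg_l (8 * INR m)); [lra|].
  replace (1 + 1 + 1 + 1 + 1 + 1 + 1 + 1) with 8 by ring.
  rewrite <- Rmult_assoc, Rinv_r by lra; lra.
Qed.

Lemma bsum_single_le (n j : nat) (g : nat -> R) (c : R) : 0 <= c -> g j <= c ->
  (forall i, i <> j -> g i <= 0) -> bsum n g <= c.
Proof.
  intros Hc Hj Hi.
  assert (bsum n g <= if lt_dec j n then c else 0).
  { induction n as [|n IH]; simpl; [destruct (lt_dec j 0); lia || lra|].
    destruct (Nat.eq_dec n j) as [->|Hn].
    - destruct (lt_dec j j); [lia|]; destruct (lt_dec j (S j)); [lra | lia].
    - specialize (Hi n Hn); destruct (lt_dec j n), (lt_dec j (S n)); lia || lra. }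
  destruct (lt_dec j n); lra.
Qed.

(** The q-th power of the L_q distance between the images of [y] and [z]. *)
Definition lqsum (q : R) (n M : nat) (y z : cfg) : R :=
  bsum n (fun j => powp (Rabs (tent (Z.of_nat M) (y j) - tent (Z.of_nat M) (z j))) q).

Lemma lqsum_ge0 (q : R) (n M : nat) (y z : cfg) : 0 <= lqsum q n M y z.
Proof. apply bsum_ge0; intros; apply powp_ge0. Qed.

(** Coordinatewise: each [x j] is uniform on the residues, and moves by [2 m] in either direction
    with probability [tau / 2]. *)
Lemma lqsum_far (q tau : R) (n m : nat) : 0 <= q -> (0 < m)%nat -> 0 <= tau <= 1 ->
  INR n * (tau * (powp (2 * INR m) q / 4)) <= far_term m n (8 * m) tau (lqsum q n (8 * m)).
Proof.
  intros Hq Hm Ht; assert (HM : (0 < 8 * m)%nat) by lia.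
  unfold far_term, lqsum.
  set (M := (8 * m)%nat) in *.
  set (g := fun v w => powp (Rabs (tent (Z.of_nat M) (v + 2 * Z.of_nat m * w)
                                   - tent (Z.of_nat M) v)) q).
  rewrite (wsum_ext _ _ (fun x => bsum n (fun j =>
    wsum (pm (tri tau) n) (fun e => g (x j) (e j))))) by (intros x; apply wsum_bsum).
  rewrite wsum_bsum, <- bsum_const; apply bsum_le; intros j Hj.
  assert (EM : wsum (pm (uni M) n) (fun x => wsum (pm (tri tau) n) (fun e => g (x j) (e j))) =
    wsum (uni M) (fun v => wsum (tri tau) (g v))).
  { rewrite <- (pm_marginal _ _ n j (fun v => wsum (tri tau) (g v)) (uni_prob M HM) Hj).
    apply wsum_ext; intros x; apply (pm_marginal _ _ n j (g (x j)) (tri_prob tau Ht) Hj). }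
  eapply Rle_trans; [|apply Req_le; symmetry; exact EM].
  apply Rle_trans with (wsum (uni M) (fun v => tau / 2 * (g v 1%Z + g v (-1)%Z))).
  - rewrite wsum_scal, wsum_plus.
    pose proof (tent_far m q 1 Hm Hq (or_introl eq_refl)) as F1.
    pose proof (tent_far m q (-1) Hm Hq (or_intror eq_refl)) as F2.
    fold M in F1, F2; change (powp (2 * INR m) q / 4 <= wsum (uni M) (fun v => g v 1%Z)) in F1.
    change (powp (2 * INR m) q / 4 <= wsum (uni M) (fun v => g v (-1)%Z)) in F2.
    nra.
  - apply (prob_le _ _ _ _ (uni_prob M HM)); intros v _; rewrite wsum_tri.
    assert (0 <= (1 - tau) * g v 0%Z) by (apply Rmult_le_pos; [lra | apply powp_ge0]); lra.
Qed.

Lemma lqsum_edge (q : R) (n M j : nat) (y z : cfg) : 0 <= q -> (0 < M)%nat ->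
  (forall i, i <> j -> y i = z i) -> (z j + 2 = y j \/ y j + 2 = z j)%Z ->
  lqsum q n M y z <= powp 2 q.
Proof.
  intros Hq HM Hi Hj; apply (bsum_single_le n j); [apply powp_ge0 | |].
  - apply powp_le; [assumption|].
    destruct Hj as [Hj|Hj].
    + pose proof (tent_tern2 (Z.of_nat M) (z j + 1) 1 ltac:(lia) ltac:(unfold tern; lia)) as H.
      replace (z j + 1 + 1)%Z with (y j) in H by lia.
      replace (z j + 1 - 1)%Z with (z j) in H by lia; exact H.
    + pose proof (tent_tern2 (Z.of_nat M) (y j + 1) 1 ltac:(lia) ltac:(unfold tern; lia)) as H.
      replace (y j + 1 + 1)%Z with (z j) in H by lia.
      replace (y j + 1 - 1)%Z with (y j) in H by lia; rewrite Rabs_minus_sym; exact H.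
  - intros i Hij; rewrite (Hi i Hij), Rminus_diag, Rabs_R0, powp_nonpos; lra.
Qed.

Lemma lqsum_le (q : R) (n M : nat) (y z : cfg) : 0 <= q ->
  (forall i, (i < n)%nat -> Rabs (tent (Z.of_nat M) (y i) - tent (Z.of_nat M) (z i)) <= 2) ->
  lqsum q n M y z <= INR n * powp 2 q.
Proof.
  intros Hq H; rewrite <- bsum_const; apply bsum_le; intros i Hi; apply powp_le; auto.
Qed.

Lemma mix_tern (n : nat) (e d : cfg) (i : nat) :
  (forall i, (i < n)%nat -> tern (e i)) -> (forall i, (i < n)%nat -> tern (d i)) ->
  (i < n)%nat -> tern (mix e d i).
Proof. intros He Hd Hi; unfold mix; destruct (Z.eq_dec (e i) 0); auto. Qed.

Lemma off_tern (n : nat) (e d : cfg) (i : nat) :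
  (forall i, (i < n)%nat -> tern (d i)) -> (i < n)%nat -> tern (off e d i).
Proof. intros Hd Hi; unfold off; destruct (Z.eq_dec (e i) 0); [auto | unfold tern; lia]. Qed.

Lemma far_term_jensen (m n M : nat) (tau s : R) (U : cfg -> cfg -> R) : 1 <= s -> (0 < M)%nat ->
  0 <= tau <= 1 -> (forall y z, 0 <= U y z) ->
  powp (far_term m n M tau U) s <= far_term m n M tau (fun y z => powp (U y z) s).
Proof.
  intros Hs HM Ht HU; unfold far_term.
  assert (Pu := pm_prob _ _ n (uni_prob M HM)).
  assert (Pt := pm_prob _ _ n (tri_prob tau Ht)).
  eapply Rle_trans; [apply (prob_jensen _ _ _ s Hs Pu)|].
  - intros x; apply (prob_ge_const _ _ _ _ Pt); auto.
  - apply (prob_le _ _ _ _ Pu); intros x _; apply (prob_jensen _ _ _ s Hs Pt); auto.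
Qed.

(** [Phi] will be the p-th power of the distance of the images in L_p. Jensen with exponent [s]
    bounds the far term below. Above, an edge moves one coordinate by 2, while diagonal and near
    pairs move each of the [n] coordinates by at most 2, whence the factor [n^s]. *)
Lemma embedding_estimate (p q s A B K tau : R) (m n : nat) (Phi : cfg -> cfg -> R) :
  0 <= q -> 1 <= s -> 0 <= A -> 0 <= B -> 0 <= K -> (0 < m)%nat -> 0 <= tau <= 1 ->
  (forall y z, A * powp (lqsum q n (8 * m) y z) s <= Phi y z <= B * powp (lqsum q n (8 * m) y z) s) ->
  Xp_ineq p K m n (8 * m) tau Phi ->
  A * powp (INR n * (tau * (powp (2 * INR m) q / 4))) s <=
  K * B * powp (powp 2 q) s *
    (powp (INR m) p * (2 * tau * INR n + powp tau (p / 2) * powp (INR n) s) + powp (INR n) s).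
Proof.
  intros Hq Hs HA HB HK Hm Ht HPhi HX; set (M := (8 * m)%nat) in *.
  assert (HM : (0 < M)%nat) by lia.
  assert (Pu := pm_prob _ _ n (uni_prob M HM)).
  assert (Ps := pm_prob _ _ n sgn_prob).
  assert (Pt := pm_prob _ _ n (tri_prob tau Ht)).
  set (c := powp (powp 2 q) s).
  assert (Hc : 0 <= c) by apply powp_ge0.
  pose proof (pos_INR n) as Hn.
  assert (Hb : forall y z b, lqsum q n M y z <= b -> Phi y z <= B * powp b s).
  { intros y z b Hl; eapply Rle_trans; [apply HPhi|].
    apply Rmult_le_compat_l; [assumption | apply powp_le; lra]. }
  assert (Hbn : forall y z, (forall i, (i < n)%nat ->
    Rabs (tent (Z.of_nat M) (y i) - tent (Z.of_nat M) (z i)) <= 2) ->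
    Phi y z <= B * (powp (INR n) s * c)).
  { intros y z H; unfold c; rewrite <- powp_mult by (assumption || apply powp_ge0).
    apply Hb, lqsum_le; assumption. }
  eapply Rle_trans; [|eapply Rle_trans; [exact HX|]].
  - eapply Rle_trans.
    { apply Rmult_le_compat_l; [assumption|].
      eapply Rle_trans; [apply powp_le; [lra | apply (lqsum_far q tau n m Hq Hm Ht)]|].
      apply far_term_jensen; auto using lqsum_ge0. }
    unfold far_term at 1; rewrite <- wsum_scal.
    apply (prob_le _ _ _ _ Pu); intros x _; rewrite <- wsum_scal.
    apply (prob_le _ _ _ _ Pt); intros e _; apply HPhi.
  - assert (E : bsum n (fun j => edge_term n M j Phi) <= INR n * (2 * (B * c))).
    { rewrite <- bsum_const; apply bsum_le; intros j Hj; unfold edge_term.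
      apply (prob_le_const _ _ _ _ Pu); intros x _; apply (prob_le_const _ _ _ _ Ps); intros e _.
      apply (prob_le_const _ _ _ _ Ps); intros d _.
      assert (V : forall v i, v <> 0%Z -> mix (upd e j v) d i = if Nat.eq_dec i j then v else mix e d i).
      { intros v i Hv; unfold mix, upd.
        destruct (Nat.eq_dec i j); [destruct (Z.eq_dec v 0); [lia | reflexivity] | reflexivity]. }
      assert (E1 : Phi (cadd x (mix (upd e j 1) d)) (cadd x (mix (upd e j (-1)) d)) <= B * c).
      { apply Hb, (lqsum_edge q n M j); auto; unfold cadd; [intros i Hi|];
          rewrite !V by lia; destruct (Nat.eq_dec _ _); try contradiction; lia. }
      assert (E2 : Phi (csub x (mix (upd e j 1) d)) (csub x (mix (upd e j (-1)) d)) <= B * c).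
      { apply Hb, (lqsum_edge q n M j); auto; unfold csub; [intros i Hi|];
          rewrite !V by lia; destruct (Nat.eq_dec _ _); try contradiction; lia. }
      lra. }
    assert (D : diag_term n M Phi <= B * (powp (INR n) s * c)).
    { apply (prob_le_const _ _ _ _ Pu); intros x _; apply (prob_le_const _ _ _ _ Ps); intros e [He _].
      apply (prob_le_const _ _ _ _ Ps); intros d [Hd _].
      apply Hbn; intros i Hi; apply tent_tern2; [lia | apply (mix_tern n); assumption]. }
    assert (N : near_term n M tau Phi <= B * (powp (INR n) s * c)).
    { apply (prob_le_const _ _ _ _ Pu); intros x _; apply (prob_le_const _ _ _ _ Pt); intros e _.
      apply (prob_le_const _ _ _ _ Ps); intros d [Hd _].
      apply Hbn; intros i Hi; apply Rle_trans with 1; [|lra].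
      apply tent_tern; [lia | apply (off_tern n); assumption]. }
    apply Rle_trans with (K * (powp (INR m) p * (tau * (INR n * (2 * (B * c)))
      + powp tau (p / 2) * (B * (powp (INR n) s * c))) + B * (powp (INR n) s * c))).
    + apply Rmult_le_compat_l; [assumption|]; apply Rplus_le_compat; [|assumption].
      apply Rmult_le_compat_l; [apply powp_ge0|]; apply Rplus_le_compat;
        apply Rmult_le_compat_l; try apply powp_ge0; try assumption; lra.
    + right; ring.
Qed.

Lemma powp_INR_unbounded (a b : R) : 0 < a -> exists n : nat, (0 < n)%nat /\ b < powp (INR n) a.
Proof.
  intros Ha; destruct (INR_unbounded (powp (Rabs b + 1) (/ a))) as [n Hn].
  pose proof (powp_ge0 (Rabs b + 1) (/ a)) as H0.
  exists n; split; [apply INR_lt; simpl; lra|].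
  apply Rlt_le_trans with (Rabs b + 1); [pose proof (Rle_abs b); lra|].
  pose proof (Rabs_pos b).
  rewrite <- (powp_1 (Rabs b + 1)) by lra.
  replace 1 with (/ a * a) at 2 by (field; lra).
  rewrite <- powp_powp; apply powp_le; lra.
Qed.

Lemma snowflake_obstruction (p q theta : R) : 2 < q -> q < p -> 0 < theta ->
  bilip_embeds (fun x y : Lp q => powp (Lp_dist q x y) theta) (Lp_dist p) -> theta <= q / p.
Proof.
  intros Hq Hpq Hth [sc [D [F [Hsc [HD HF]]]]].
  apply Rnot_lt_le; intros Hbig.
  set (s := / q * theta * p).
  assert (Hs : 1 < s).
  { apply (Rmult_lt_reg_l (q / p)); [apply Rdiv_lt_0_compat; lra|].
    rewrite Rmult_1_r; unfold s.
    replace (q / p * (/ q * theta * p)) with theta by (field; lra); assumption. }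
  destruct (Lp_Xp_ineq p ltac:(lra)) as [K [HK HX]].
  set (A := powp sc p); set (B := powp (D * sc) p).
  assert (HA : 0 < A) by (apply powp_gt0; lra).
  assert (HB : 0 <= B) by apply powp_ge0.
  set (c := K * B * powp (powp 2 q) s).
  assert (Hmain : forall m n : nat, (0 < m)%nat -> (0 < n)%nat ->
    A * (powp (INR n) s * powp (2 * INR m) ((q - 2) * s)) <=
    c * (2 * powp (INR m) (p - 2) * INR n + 2 * powp (INR n) s)).
  { intros m n Hm Hn; set (M := (8 * m)%nat).
    assert (0 < INR m) by (apply lt_0_INR; assumption).
    assert (1 <= INR m) by (apply (le_INR 1); lia).
    pose proof (pos_INR n).
    destruct (Lq_contains_lq q n ltac:(lra)) as [P HP].
    (* The cutoff at [n] makes the map depend only on the first [n] coordinates, as [resp]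
       demands. *)
    set (co := fun (x : cfg) (j : nat) => if lt_dec j n then tent (Z.of_nat M) (x j) else 0).
    (* With this choice [m^p tau^(p/2) = 1], so the diagonal and near contributions have equal
       size. *)
    set (tau := / (INR m * INR m)).
    assert (Ht : 0 <= tau <= 1).
    { split; [left; apply Rinv_0_lt_compat; nra|].
      rewrite <- Rinv_1; apply Rinv_le_contravar; nra. }
    assert (HR : resp n M (fun x => F (P (co x)))).
    { intros x y Hxy; do 2 f_equal; extensionality j; unfold co.
      destruct (lt_dec j n); [apply tent_periodic; [lia | auto] | reflexivity]. }
    specialize (HX m n M tau _ Hm ltac:(lia) Ht HR).
    assert (HPhi : forall y z,
      A * powp (lqsum q n M y z) s <= powp (Lp_dist p (F (P (co y))) (F (P (co z)))) p
      <= B * powp (lqsum q n M y z) s).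
    { intros y z; destruct (HF (P (co y)) (P (co z))) as [F1 F2].
      rewrite HP in F1, F2.
      assert (E : bsum n (fun j => powp (Rabs (co y j - co z j)) q) = lqsum q n M y z).
      { apply bsum_ext; intros j Hj; unfold co; destruct (lt_dec j n); [reflexivity | lia]. }
      rewrite E, powp_powp in F1, F2.
      unfold A, B, s; rewrite <- !(powp_powp _ (/ q * theta) p).
      rewrite <- !powp_mult by (apply powp_ge0 || nra).
      split; apply powp_le; lra. }
    pose proof (embedding_estimate p q s A B K tau m n _ ltac:(lra) ltac:(lra) ltac:(lra) HB HK
      Hm Ht HPhi HX) as E.
    fold c in E.
    assert (T1 : INR n * (tau * (powp (2 * INR m) q / 4)) = INR n * powp (2 * INR m) (q - 2)).
    { f_equal; unfold tau.
      replace q with (q - 2 + 2) at 1 by ring; rewrite powp_plus, powp_2 by lra; field; lra. }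
    rewrite T1, powp_mult, powp_powp in E by (assumption || apply powp_ge0).
    eapply Rle_trans; [exact E|]; right; f_equal.
    assert (T2 : powp (INR m) p = powp (INR m) (p - 2) * (INR m * INR m)).
    { rewrite <- powp_2, <- powp_plus by lra; f_equal; ring. }
    assert (T3 : powp (INR m) p * powp tau (p / 2) = 1).
    { replace (powp (INR m) p) with (powp (INR m * INR m) (p / 2)).
      - rewrite <- powp_mult by (lra || nra); unfold tau; rewrite Rinv_r by nra; apply powp_base1.
      - rewrite powp_Rabs_sq, Rabs_pos_eq by lra; f_equal; field. }
    rewrite Rmult_plus_distr_l, <- (Rmult_assoc _ (powp tau _)), T3.
    rewrite T2; unfold tau; field; lra. }
  assert (Hc : 0 <= c) by (repeat apply Rmult_le_pos; try assumption; apply powp_ge0).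
  (* First [m] makes [A m^((q-2) s)] exceed [4 c]; then [n] makes [n^(s-1)] exceed [m^(p-2)], so
     that all terms on the right are at most multiples of [n^s]. *)
  destruct (powp_INR_unbounded ((q - 2) * s) (4 * c / A) ltac:(nra)) as [m [Hm Bm]].
  destruct (powp_INR_unbounded (s - 1) (powp (INR m) (p - 2)) ltac:(lra)) as [n [Hn Bn]].
  specialize (Hmain m n Hm Hn).
  assert (0 < INR n) by (apply lt_0_INR; assumption).
  pose proof (pos_INR m).
  set (X := powp (INR n) s) in *.
  assert (HXp : 0 < X) by (apply powp_gt0; assumption).
  assert (Y : powp (INR m) (p - 2) * INR n <= X).
  { unfold X; rewrite (powp_minus1 (INR n) s) by lra; apply Rmult_le_compat_r; lra. }
  assert (Z : powp (INR m) ((q - 2) * s) <= powp (2 * INR m) ((q - 2) * s))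
    by (apply powp_le; [nra | lra]).
  assert (W : A * (X * powp (2 * INR m) ((q - 2) * s)) <= c * (4 * X)).
  { eapply Rle_trans; [exact Hmain|]; apply Rmult_le_compat_l; [assumption | lra]. }
  assert (W' : A * powp (2 * INR m) ((q - 2) * s) <= 4 * c) by nra.
  assert (A * (4 * c / A) < A * powp (2 * INR m) ((q - 2) * s))
    by (apply Rmult_lt_compat_l; lra).
  replace (A * (4 * c / A)) with (4 * c) in * by (field; lra); lra.
Qed.

(** With [N = p q - 3 q + 2], the middle quantity is the positive root of
    [p (q-2) T^2 + q N T = q^2 (p-2)]. The bounds compare it with [q / p] and with [1 - u], by
    squaring away the root [S]. *)
Lemma threshold_bounds (p q : R) : 2 < q -> q < p ->
  q / p <= (2 * q * (p - q) + q ^ 2 * (p - 1) * (p - 2)) / (2 * p ^ 2 * (q - 2)) *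
           (sqrt (1 + 4 * p * (p - 2) * (q - 2) / (p * q - 3 * q + 2) ^ 2) - 1)
        <= 1 - (p - q) * (q - 2) / (2 * p ^ 3).
Proof.
  intros Hq Hpq.
  set (N := p * q - 3 * q + 2).
  assert (HN : 0 < N) by (unfold N; destruct (Rle_dec 3 p); nra).
  (* The numerator factors as [p q N]. *)
  replace ((2 * q * (p - q) + q ^ 2 * (p - 1) * (p - 2)) / (2 * p ^ 2 * (q - 2)))
    with (q * N / (2 * p * (q - 2))) by (unfold N; field; lra).
  set (S := sqrt (1 + 4 * p * (p - 2) * (q - 2) / N ^ 2)).
  assert (HN2 : 0 < N ^ 2) by (apply pow_lt; assumption).
  assert (Hk : 0 < q * N / (2 * p * (q - 2))) by (apply Rdiv_lt_0_compat; nra).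
  set (u := (p - q) * (q - 2) / (2 * p ^ 3)).
  assert (Hp3 : 0 < 2 * p ^ 3) by (assert (0 < p ^ 3) by (apply pow_lt; lra); lra).
  assert (Hu : 0 < u) by (apply Rdiv_lt_0_compat; nra).
  assert (Hu2 : 2 * p ^ 3 * u = (p - q) * (q - 2)) by (unfold u; field; lra).
  assert (Hu1 : u <= 1).
  { apply (Rmult_le_reg_l (2 * p ^ 3)); [assumption|]; rewrite Hu2; simpl; nra. }
  split.
  (* Squared and simplified, this is [q (p - 2) <= p (p - 2)]. *)
  - assert (L : 1 + 2 * (q - 2) / N <= S).
    { unfold S; rewrite <- (sqrt_Rsqr (1 + 2 * (q - 2) / N)).
      - apply sqrt_le_1_alt; unfold Rsqr.
        apply (Rmult_le_reg_l (N ^ 2)); [assumption|].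
        replace (N ^ 2 * ((1 + 2 * (q - 2) / N) * (1 + 2 * (q - 2) / N)))
          with ((N + 2 * (q - 2)) * (N + 2 * (q - 2))) by (field; lra).
        replace (N ^ 2 * (1 + 4 * p * (p - 2) * (q - 2) / N ^ 2))
          with (N * N + 4 * p * (p - 2) * (q - 2)) by (field; lra).
        assert (0 <= (q - 2) * ((p - q) * (p - 2))) by (apply Rmult_le_pos; nra).
        unfold N; nra.
      - assert (0 <= 2 * (q - 2) / N) by (apply Rdiv_le_0_compat; lra); lra. }
    apply Rle_trans with (q * N / (2 * p * (q - 2)) * (2 * (q - 2) / N)).
    + right; field; lra.
    + apply Rmult_le_compat_l; lra.
  - set (T := 1 - u).
    assert (HT : 0 <= T) by (unfold T; lra).
    (* At [T = 1] the right side exceeds the left by [(p - q) (q - 2) = 2 p^3 u]. Lowering [T] by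
       [u] costs at most [u (2 p (q - 2) + q N)], and the bracket is at most [2 p^3]. *)
    assert (HP : q ^ 2 * (p - 2) <= q * N * T + p * (q - 2) * T ^ 2).
    { unfold T.
      assert (E : q * N * (1 - u) + p * (q - 2) * (1 - u) ^ 2 - q ^ 2 * (p - 2) =
        (p - q) * (q - 2) - u * (2 * p * (q - 2) + q * N) + p * (q - 2) * u ^ 2)
        by (unfold N; ring).
      rewrite <- Hu2 in E.
      assert (Q : 2 * p * (q - 2) + q * N <= 2 * p ^ 3).
      { unfold N.
        assert (q * q * p <= p * p * p) by (apply Rmult_le_compat_r; nra).
        assert (2 * p * q <= p * p * p) by (apply Rmult_le_compat; nra).
        simpl; nra. }
      assert (u * (2 * p * (q - 2) + q * N) <= u * (2 * p ^ 3))
        by (apply Rmult_le_compat_l; lra).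
      assert (0 <= p * (q - 2) * u ^ 2) by (apply Rmult_le_pos; nra).
      lra. }
    assert (U : S <= 1 + 2 * p * (q - 2) * T / (q * N)).
    { assert (0 <= 2 * p * (q - 2) * T / (q * N))
        by (apply Rdiv_le_0_compat; [apply Rmult_le_pos|]; nra).
      unfold S; rewrite <- (sqrt_Rsqr (1 + 2 * p * (q - 2) * T / (q * N))) by lra.
      apply sqrt_le_1_alt; unfold Rsqr.
      apply Rle_trans with (1 + 4 * p * (q - 2) / (q ^ 2 * N ^ 2) * (q ^ 2 * (p - 2))).
      - right; field; lra.
      - apply Rle_trans with (1 + 4 * p * (q - 2) / (q ^ 2 * N ^ 2) *
          (q * N * T + p * (q - 2) * T ^ 2)).
        + apply Rplus_le_compat_l, Rmult_le_compat_l; [|assumption].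
          apply Rdiv_le_0_compat; [nra | apply Rmult_lt_0_compat; nra].
        + right; field; lra. }
    apply Rle_trans with (q * N / (2 * p * (q - 2)) * (2 * p * (q - 2) * T / (q * N))).
    + apply Rmult_le_compat_l; lra.
    + right; field; lra.
Qed.

Theorem mainTheorem4 (p q theta : R) :
  2 < q -> q < p -> 0 < theta < 1 ->
  bilip_embeds (fun x y : Lp q => powp (Lp_dist q x y) theta) (Lp_dist p) ->
  theta <= (2 * q * (p - q) + q ^ 2 * (p - 1) * (p - 2)) / (2 * p ^ 2 * (q - 2)) *
           (sqrt (1 + 4 * p * (p - 2) * (q - 2) / (p * q - 3 * q + 2) ^ 2) - 1)
  /\ (2 * q * (p - q) + q ^ 2 * (p - 1) * (p - 2)) / (2 * p ^ 2 * (q - 2)) *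
           (sqrt (1 + 4 * p * (p - 2) * (q - 2) / (p * q - 3 * q + 2) ^ 2) - 1)
     <= 1 - (p - q) * (q - 2) / (2 * p ^ 3).
Proof.
  intros Hq Hpq [Hth _] Hemb.
  destruct (threshold_bounds p q Hq Hpq) as [H1 H2].
  split; [|exact H2].
  eapply Rle_trans; [apply (snowflake_obstruction p q theta); assumption | exact H1].
Qed.
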